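(* Let $k$ be a field, $R=k[x,y,z]$ with the standard grading, and let $s\geq 3$ be an integer. Let $I\subset R$ be a homogeneous ideal of grade $3$ such that $R/I$ is compressed with $\operatorname{Soc}(R/I)\cong k(-s)\oplus k(-2s+1)$. Then $R/I$ has Tor algebra class $G(\mu(I)-3)$, where $\mu(I)$ is the minimal number of generators of $I$.
   Context: The socle isomorphism is as graded vector spaces: one basis element in degree $s$ and one in degree $2s-1$. $R/I$ compressed means: with $c_\ell=\dim_k \operatorname{Soc}(R/I)_\ell$, $\dim_k (R/I)_i=\min\{\binom{2+i}{i},\ \sum_{\ell=0}^{2s-1} c_\ell\binom{2+\ell-i}{\ell-i}\}$ for $0\le i\le 2s-1$, where binomials with $\ell<i$ are $0$. Tor algebra class: for a homogeneous ideal $I\subseteq R_+^2$ with $\operatorname{pd}_R(R/I)=3$, let $T_\bullet=\operatorname{Tor}_\bullet^R(R/I,k)$ with its graded-commutative algebra structure, $m=\mu(I)$, and $t$ the type of $R/I$. $R/I$ has Tor algebra class $G(r)$ ($r\geq 2$) if there exist bases $e_1,\dots,e_m$ of $T_1$, $f_1,\dots,f_{m+t-1}$ of $T_2$, $g_1,\dots,g_t$ of $T_3$ such that the only nonzero products of basis elements of positive degree are $e_if_i=g_1=f_ie_i$ for $1\leq i\leq r$ (so $T_1\cdot T_1=0$, $\operatorname{rank}_k(T_1\cdot T_2)=1$, and the map $T_2\to\operatorname{Hom}_k(T_1,T_3)$ has rank $r$). *)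

(* Defs.v *)
From HB Require Import structures.
From mathcomp Require Export all_boot all_order all_algebra.
From mathcomp Require Export mpoly.

Set Implicit Arguments.
Unset Strict Implicit.
Unset Printing Implicit Defensive.

Import GRing.Theory.
Local Open Scope ring_scope.

Section QuotientBases.
Variables (k : fieldType) (V : lmodType k).

(* The subquotient Z / (Z \cap B) of V, for subspaces Z and B, is never formed
   as a type: [v] represents a basis of it. *)
Definition basis_mod (Z B : V -> Prop) (n : nat) (v : 'I_n -> V) : Prop :=
  [/\ forall i, Z (v i),
      forall a : 'I_n -> k, B (\sum_i a i *: v i) -> forall i, a i = 0
    & forall z, Z z -> exists a : 'I_n -> k, B (z - \sum_i a i *: v i)].

Definition dim_mod (Z B : V -> Prop) (n : nat) : Prop :=
  exists v : 'I_n -> V, basis_mod Z B v.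

End QuotientBases.

Section Grade.
Variable R : comNzRingType.

Definition ideal_gen (fs : seq R) (p : R) : Prop :=
  exists a : 'I_(size fs) -> R, p = \sum_(i < size fs) a i * fs`_i.

Definition regular_seq (fs : seq R) : Prop :=
  (forall i, (i < size fs)%N -> forall a,
     ideal_gen (take i fs) (a * fs`_i) -> ideal_gen (take i fs) a)
  /\ ~ ideal_gen fs 1.

(* The grade of a proper ideal I is the maximal length of a regular sequence
   contained in I. *)
Definition has_grade (I : {pred R}) (g : nat) : Prop :=
  (exists fs : seq R, [/\ size fs = g, {subset fs <= I} & regular_seq fs])
  /\ (forall fs : seq R, {subset fs <= I} -> regular_seq fs -> (size fs <= g)%N).

Definition generates (I : {pred R}) (fs : seq R) : Prop :=
  forall p, p \in I <-> ideal_gen fs p.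

Definition min_num_gens (I : {pred R}) (m : nat) : Prop :=
  (exists2 fs : seq R, size fs = m & generates I fs)
  /\ (forall fs : seq R, generates I fs -> (m <= size fs)%N).

End Grade.

Section GradedQuotient.
Variables (k : fieldType) (n : nat).
Local Notation R := {mpoly k[n]}.
Variable I : {pred R}.

Definition homogeneous_ideal : Prop :=
  idealr_closed I /\ (forall p d, p \in I -> pihomog mdeg d p \in I).

(* I is contained in the square of the irrelevant ideal R_+ = (x_1, ..., x_n). *)
Definition sub_irrelevant_sq : Prop :=
  forall p, p \in I ->
    ideal_gen [seq 'X_i * 'X_j | i <- enum 'I_n, j <- enum 'I_n] p.

(* dim_k (R/I)_d = h *)
Definition hilbert_fun (d h : nat) : Prop :=
  dim_mod (fun p : R => p \is d.-homog) (fun p => p \in I) h.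

(* Representatives in R of the elements of Soc(R/I) = 0 :_{R/I} R_+. *)
Definition socle (p : R) : Prop := forall i : 'I_n, 'X_i * p \in I.

(* dim_k Soc(R/I)_d = c *)
Definition socle_dim (d c : nat) : Prop :=
  dim_mod (fun p : R => p \is d.-homog /\ socle p) (fun p => p \in I) c.

(* Soc(R/I) is isomorphic to the direct sum of the k(-d), d in ds, as a graded
   vector space. *)
Definition socle_iso (ds : seq nat) : Prop :=
  exists2 v : 'I_(size ds) -> R,
    forall i : 'I_(size ds), v i \is (nth 0%N ds i).-homog
  & basis_mod socle (fun p => p \in I) v.

Definition has_type (t : nat) : Prop :=
  dim_mod socle (fun p => p \in I) t.

End GradedQuotient.

(* e is the top socle degree.  'C(2 + i, i) = dim_k R_i for R = k[x, y, z];
   restricting the sum to l >= i implements the convention that the binomials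
   with l < i vanish. *)
Definition compressed (k : fieldType) (I : {pred {mpoly k[3]}}) (e : nat) : Prop :=
  exists2 c : nat -> nat, (forall l, socle_dim I l (c l))
    & forall i, (i <= e)%N ->
        hilbert_fun I i
          (minn 'C(2 + i, i)
                (\sum_(i <= l < e.+1) c l * 'C(2 + (l - i), l - i))%N).

Section TorAlgebra.
Variables (k : fieldType) (n : nat).
Local Notation R := {mpoly k[n]}.

(* Tor^R(R/I, k) is computed from the Koszul complex K on the variables, which
   is a differential graded algebra and a free resolution of k over R: it is
   the homology algebra of K/IK = R/I (x) K.  K is the exterior algebra over R
   on T_1, ..., T_n with differential T_i |-> x_i; an element a of K has
   coefficient a U on T_U = T_{u_1} ... T_{u_p}, where u_1 < ... < u_p are the
   elements of U. *)
Definition koszul := {ffun {set 'I_n} -> R}.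

(* T_U T_V = (-1) ^ inv_count U V T_(U :|: V) if U and V are disjoint, else 0. *)
Definition inv_count (U V : {set 'I_n}) : nat :=
  #|[set ij : 'I_n * 'I_n | [&& ij.1 \in U, ij.2 \in V & (ij.2 < ij.1)%N]]|.

Definition kmul (a b : koszul) : koszul :=
  [ffun W : {set 'I_n} =>
     \sum_(U : {set 'I_n} | U \subset W)
       (-1) ^+ inv_count U (W :\: U) * (a U * b (W :\: U))].

Definition kdiff (a : koszul) : koszul :=
  [ffun W : {set 'I_n} =>
     \sum_(i : 'I_n | i \notin W)
       (-1) ^+ #|[set j in W | (j < i)%N]| * ('X_i * a (i |: W))].

Definition kdeg (p : nat) (a : koszul) : Prop :=
  forall U : {set 'I_n}, #|U| != p -> a U = 0.

Variable I : {pred R}.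

Definition in_IK (a : koszul) : Prop := forall U, a U \in I.

(* Tor_p = tor_cycle p / tor_zero p. *)
Definition tor_cycle (p : nat) (a : koszul) : Prop :=
  kdeg p a /\ in_IK (kdiff a).

Definition tor_zero (p : nat) (a : koszul) : Prop :=
  kdeg p a /\ exists2 b : koszul, kdeg p.+1 b & in_IK (a - kdiff b).

Definition tor_basis (p m : nat) (v : 'I_m -> koszul) : Prop :=
  basis_mod (tor_cycle p) (tor_zero p) v.

Definition tor_eq (p : nat) (a b : koszul) : Prop := tor_zero p (a - b).

End TorAlgebra.

(* R/I has Tor algebra class G(r).  The type of R/I is written t.+1, so that
   dim T_2 = m + (t.+1) - 1 = m + t and g ord0 is g_1.  Products landing in
   degree at least 4 vanish already in the Koszul algebra on three variables,
   which is why only T_1 T_1, T_1 T_2 and T_2 T_1 appear.  That pd (R/I) = 3 is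
   forced by T_3 being nonzero. *)
Definition tor_class_G (k : fieldType) (I : {pred {mpoly k[3]}}) (r : nat) : Prop :=
  [/\ (2 <= r)%N, sub_irrelevant_sq I
    & exists m t : nat,
      [/\ min_num_gens I m, has_type I t.+1, (r <= m)%N
        & exists (e : 'I_m -> koszul k 3) (f : 'I_(m + t) -> koszul k 3)
                 (g : 'I_t.+1 -> koszul k 3),
          [/\ tor_basis I 1 e, tor_basis I 2 f, tor_basis I 3 g,
              forall i j, tor_zero I 2 (kmul (e i) (e j))
            & forall (i : 'I_m) (j : 'I_(m + t)),
                if ((i : nat) == j) && (i < r)%N
                then tor_eq I 3 (kmul (e i) (f j)) (g ord0)
                     /\ tor_eq I 3 (kmul (f j) (e i)) (g ord0)
                else tor_zero I 3 (kmul (e i) (f j))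
                     /\ tor_zero I 3 (kmul (f j) (e i))]]].

(* Main.v *)
From HB Require Import structures.
Require Import Defs.
From mathcomp Require Import all_boot all_order all_algebra.
From mathcomp Require Import mpoly.
From mathcomp Require Import ring zify.
From Stdlib Require Import Classical.

(** Let e = 2s - 1 and let phi be a functional on R_e with kernel I_e. Pairing
    with phi defines a Gorenstein ideal J containing I; the shape of the socle
    and the Hilbert function give J_i = 0 for i < s and J_i = I_i for i > s, and
    these two facts are all that is used of J. Koszul duality with respect to
    phi then shows that Tor_1 lives in degrees s and s+1, that Tor_2 lives in
    degrees s+1 and s+2, that the pairing of Tor_(1,s) with Tor_(2,s+2) is
    nondegenerate on the left, and that the pairing of Tor_(1,s+1) with
    Tor_(2,s+1) is nondegenerate on the right. All other products vanish for
    degree reasons, so Tor_1 x Tor_2 -> Tor_3 has rank s + t with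
    t = dim Tor_(2,s+1). Counting dimensions in degree s+1 gives
    dim Tor_(1,s+1) = t + 3, hence mu(I) = s + t + 3. *)

Set Implicit Arguments.
Unset Strict Implicit.
Unset Printing Implicit Defensive.

Import GRing.Theory.
Local Open Scope ring_scope.

(** * Bases of subquotients *)

Section Subspaces.
Variable k : fieldType.

(** J is never built as an ideal: membership of a form of degree d is the condition [orth d], that
    it multiplies R_(e-d) into I. In degree s itself J is larger than I, by the line of [sigma]. The
    duality makes a triple exact only up to J, which is as good as I above degree s and as 0 below
    it, but of no use in degree s. This is why each pairing is shown nondegenerate on one side only.
    One side is enough: the pairing matrix is block diagonal with an s x (s+4) block of full row
    rank and a (t+3) x t block of full column rank.

    The constant 3 comes from the Hilbert function: I_(s+1) has dimension 3s + 3, while R_1 I_s has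
    dimension 3s - t, where t also counts the linear syzygies of I_s.

    Since Tor is defined by the Koszul algebra, all classes are represented by triples of
    polynomials. The Leibniz and adjointness rules then become identities of vector calculus, valid
    over every field. *)

Definition subspace (V : lmodType k) (P : V -> Prop) : Prop :=
  P 0 /\ forall a u v, P u -> P v -> P (a *: u + v).

Section Closure.
Variables (V : lmodType k) (P : V -> Prop) (sP : subspace P).

Lemma subspace0 : P 0. Proof. by case: sP. Qed.

Lemma subspaceD u v : P u -> P v -> P (u + v).
Proof. by move=> Pu Pv; rewrite -[u]scale1r; apply: sP.2. Qed.

Lemma subspaceZ a u : P u -> P (a *: u).
Proof. by move=> Pu; rewrite -[_ *: _]addr0; apply: sP.2 => //; apply: sP.1. Qed.

Lemma subspaceN u : P u -> P (- u).
Proof. by move=> Pu; rewrite -scaleN1r; apply: subspaceZ. Qed.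

Lemma subspaceB u v : P u -> P v -> P (u - v).
Proof. by move=> Pu Pv; apply/subspaceD/subspaceN. Qed.

Lemma subspace_sum n (F : 'I_n -> V) : (forall i, P (F i)) -> P (\sum_i F i).
Proof. by move=> PF; elim/big_ind: _ => //; [apply: subspace0 | apply: subspaceD]. Qed.

Lemma subspace_lin n (a : 'I_n -> k) (F : 'I_n -> V) :
  (forall i, P (F i)) -> P (\sum_i a i *: F i).
Proof. by move=> PF; apply: subspace_sum => i; apply: subspaceZ. Qed.

End Closure.

Lemma subspace_eq0 (V : lmodType k) : subspace (fun z : V => z = 0).
Proof. by split=> // a u v -> ->; rewrite scaler0 addr0. Qed.

Definition independent_mod (V : lmodType k) (B : V -> Prop) n (v : 'I_n -> V) :=
  forall a : 'I_n -> k, B (\sum_i a i *: v i) -> forall i, a i = 0.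

Lemma row_kernel_vector n m (M : 'M[k]_(n, m)) :
  (m < n)%N -> exists2 c : 'rV_n, c != 0 & c *m M = 0.
Proof.
move=> lt_mn; have: kermx M != 0.
  rewrite kermx_eq0 /row_free neq_ltn; apply/orP; left.
  exact: leq_ltn_trans (rank_leq_col M) lt_mn.
by move=> /rowV0Pn [c /sub_kermxP cM c0]; exists c.
Qed.

Lemma sum_mulmx (V : lmodType k) n m (M : 'M[k]_(n, m)) (c : 'rV_n) (w : 'I_m -> V) :
  \sum_i c 0 i *: \sum_j M i j *: w j = \sum_j (c *m M) 0 j *: w j.
Proof.
under eq_bigr do rewrite scaler_sumr; rewrite exchange_big /=.
by apply: eq_bigr => j _; rewrite mxE scaler_suml; apply: eq_bigr => i _; rewrite scalerA.
Qed.

(** Steinitz exchange: with more vectors than generators, a nonzero row killed by the coefficient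
    matrix is a relation among the [v i] modulo [B]. *)
Lemma independent_mod_le (V : lmodType k) (B : V -> Prop) n m
    (v : 'I_n -> V) (w : 'I_m -> V) : subspace B ->
  independent_mod B v ->
  (forall i, exists a : 'I_m -> k, B (v i - \sum_j a j *: w j)) -> (n <= m)%N.
Proof.
move=> sB indv /fin_all_exists [A vA]; rewrite leqNgt; apply/negP => lt_mn.
have [c c0 cM] := row_kernel_vector (\matrix_(i, j) A i j) lt_mn.
case/negP: c0; apply/eqP/rowP => i; rewrite mxE.
apply: (indv (fun i => c 0 i)).
have := subspace_lin sB (c 0) vA.
under eq_bigr do rewrite scalerBr; rewrite sumrB.
have -> : \sum_i c 0 i *: \sum_j A i j *: w j = 0.
  transitivity (\sum_i c 0 i *: \sum_j (\matrix_(i, j) A i j) i j *: w j).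
    by apply: eq_bigr => j _; congr (_ *: _); apply: eq_bigr => l _; rewrite mxE.
  by rewrite sum_mulmx cM; apply: big1 => j _; rewrite mxE scale0r.
by rewrite subr0.
Qed.

Lemma dim_mod_uniq (V : lmodType k) (Z B : V -> Prop) n m :
  subspace B -> dim_mod Z B n -> dim_mod Z B m -> n = m.
Proof.
move=> sB [v [Zv iv gv]] [w [Zw iw gw]]; apply/eqP; rewrite eqn_leq.
by rewrite (independent_mod_le sB iv (fun i => gw _ (Zv i)))
   (independent_mod_le sB iw (fun i => gv _ (Zw i))).
Qed.

Definition catf T n m (v : 'I_n -> T) (w : 'I_m -> T) (i : 'I_(n + m)) : T :=
  match split i with inl j => v j | inr j => w j end.

Lemma catf_l T n m (v : 'I_n -> T) (w : 'I_m -> T) i : catf v w (lshift m i) = v i.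
Proof. by rewrite /catf (unsplitK (inl i)). Qed.

Lemma catf_r T n m (v : 'I_n -> T) (w : 'I_m -> T) i : catf v w (rshift n i) = w i.
Proof. by rewrite /catf (unsplitK (inr i)). Qed.

Lemma catf_ind T n m (v : 'I_n -> T) (w : 'I_m -> T) (Q : T -> Prop) :
  (forall i, Q (v i)) -> (forall i, Q (w i)) -> forall i, Q (catf v w i).
Proof. by move=> Qv Qw i; rewrite /catf; case: split. Qed.

Lemma sum_catf (V : lmodType k) n m (v : 'I_n -> V) (w : 'I_m -> V) a :
  \sum_i a i *: catf v w i =
    \sum_i a (lshift m i) *: v i + \sum_i a (rshift n i) *: w i.
Proof.
rewrite big_split_ord /=; congr (_ + _); apply: eq_bigr => i _.
  by rewrite catf_l.
by rewrite catf_r.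
Qed.

Lemma all_split n m (Q : 'I_(n + m) -> Prop) :
  (forall i, Q (lshift m i)) -> (forall i, Q (rshift n i)) -> forall i, Q i.
Proof. by move=> Ql Qr i; rewrite -(splitK i); case: split. Qed.

Lemma basis_mod_cat (V : lmodType k) (Z P B : V -> Prop) n m
    (v : 'I_n -> V) (w : 'I_m -> V) :
  subspace Z -> subspace P ->
  (forall z, B z -> P z) -> (forall z, P z -> Z z) ->
  basis_mod Z P v -> basis_mod P B w -> basis_mod Z B (catf v w).
Proof.
move=> sZ sP sBP sPZ [Zv iv gv] [Pw iw gw]; split.
- by apply: catf_ind => // i; apply/sPZ/Pw.
- move=> a; rewrite sum_catf => Ba.
  have a_l : forall i, a (lshift m i) = 0.
    apply: (iv (fun i => a (lshift m i))); move/sBP: Ba => Pa.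
    rewrite -(addrK (\sum_i a (rshift n i) *: w i) (\sum_i _)).
    by apply: (subspaceB sP) => //; apply: subspace_lin.
  apply: all_split => //; apply: (iw (fun i => a (rshift n i))).
  by rewrite big1 ?add0r // in Ba => i _; rewrite a_l scale0r.
- move=> z /gv [a Pa]; have [b Bb] := gw _ Pa.
  exists (catf a b); rewrite sum_catf.
  under eq_bigr do rewrite catf_l.
  under [X in _ - (_ + X)]eq_bigr do rewrite catf_r.
  by rewrite opprD addrA.
Qed.

Lemma independent_mod_extend (V : lmodType k) (B : V -> Prop) n (v : 'I_n -> V) z :
  subspace B -> independent_mod B v ->
  ~ (exists a : 'I_n -> k, B (z - \sum_i a i *: v i)) ->
  independent_mod B (catf (fun _ : 'I_1 => z) v).
Proof.
move=> sB iv nspan a; rewrite sum_catf big_ord1 => Ba.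
have a0 : a (lshift n 0) = 0.
  apply/eqP/negPn/negP => a0; apply: nspan.
  exists (fun i => - (a (lshift n 0))^-1 * a (rshift 1 i)).
  have := subspaceZ sB (a (lshift n 0))^-1 Ba.
  rewrite scalerDr scalerA mulVf // scale1r scaler_sumr.
  under eq_bigr do rewrite scalerA -[_ * _]opprK -mulNr scaleNr.
  by rewrite sumrN.
apply: all_split => [i|]; first by rewrite (ord1 i).
by apply: (iv (fun i => a (rshift 1 i))); move: Ba; rewrite a0 scale0r add0r.
Qed.

(** The bound [N] stops the greedy extension of an independent family. Whether a family already
    spans is decided by excluded middle, [Z] and [B] being arbitrary predicates. *)
Lemma exists_basis_mod (V : lmodType k) (Z B : V -> Prop) N :
  subspace B ->
  (forall n (v : 'I_n -> V), (forall i, Z (v i)) -> independent_mod B v -> (n <= N)%N) ->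
  exists n, dim_mod Z B n.
Proof.
move=> sB bound.
suff ext d n (v : 'I_n -> V) : (N - n <= d)%N -> (forall i, Z (v i)) ->
    independent_mod B v -> exists n, dim_mod Z B n.
  have v0 (i : 'I_0) : V by case: i.
  by apply: (@ext N 0 v0); [rewrite subn0 | case | move=> a _ []].
elim: d n v => [|d IHd] n v dn Zv iv.
all: have [spans|nspans] :=
  classic (forall z, Z z -> exists a : 'I_n -> k, B (z - \sum_i a i *: v i)).
1, 3: by exists n, v.
all: have [z nz] := not_all_ex_not _ _ nspans.
all: have [Zz nspan] := imply_to_and _ _ nz.
all: have iv' := independent_mod_extend sB iv nspan.
all: have Zv' i : Z (catf (fun _ : 'I_1 => z) v i) by exact: catf_ind.
- by have := bound _ _ Zv' iv'; rewrite add1n ltnNge -subn_eq0 -leqn0 dn.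
- by apply: IHd iv' => //; lia.
Qed.

(** Additivity of dimension along B, P, Z, the tool of all dimension counts below. Finiteness of
    both pieces is inherited from Z modulo B. *)
Lemma dim_mod_split (V : lmodType k) (Z P B : V -> Prop) N :
  subspace Z -> subspace P -> subspace B ->
  (forall z, B z -> P z) -> (forall z, P z -> Z z) -> dim_mod Z B N ->
  exists n m, [/\ dim_mod Z P n, dim_mod P B m & N = (n + m)%N].
Proof.
move=> sZ sP sB BP PZ dZ; have [w [Zw iw gw]] := dZ.
have [n dn] : exists n, dim_mod Z P n.
  apply: (@exists_basis_mod _ _ _ N) => // n v Zv iv.
  apply: (independent_mod_le sB (w := w)) => [a Ba|i]; last exact/gw/Zv.
  by apply: iv; apply: BP.
have [m dm] : exists m, dim_mod P B m.
  apply: (@exists_basis_mod _ _ _ N) => // m v Pv iv.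
  by apply: (independent_mod_le sB iv (w := w)) => i; apply/gw/PZ/Pv.
exists n, m; split=> //; apply: (dim_mod_uniq sB dZ).
have [v bv] := dn; have [u bu] := dm.
by exists (catf v u); apply: basis_mod_cat bv bu.
Qed.

(** * Linear maps and transfer of bases between subquotients *)

Definition linear_map (V W : lmodType k) (f : V -> W) :=
  forall c u v, f (c *: u + v) = c *: f u + f v.

Section LinearMaps.
Variables (V W : lmodType k) (f : V -> W) (lf : linear_map f).

Lemma linear_map0 : f 0 = 0.
Proof. by have := lf (-1) 0 0; rewrite scaler0 addr0 scaleN1r addNr. Qed.

Lemma linear_mapD u v : f (u + v) = f u + f v.
Proof. by have := lf 1 u v; rewrite !scale1r. Qed.

Lemma linear_mapB u v : f (u - v) = f u - f v.
Proof. by have := lf (-1) v u; rewrite !scaleN1r addrC => ->; rewrite addrC. Qed.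

Lemma linear_map_lin n (a : 'I_n -> k) (v : 'I_n -> V) :
  f (\sum_i a i *: v i) = \sum_i a i *: f (v i).
Proof.
elim: n a v => [|n IHn] a v; first by rewrite !big_ord0 linear_map0.
by rewrite !big_ord_recl lf IHn.
Qed.

End LinearMaps.

Section Transfer.
Variables (V W : lmodType k) (f : V -> W).
Variables (Z B : V -> Prop) (Z' B' : W -> Prop).
Hypotheses (lf : linear_map f) (sZ : subspace Z).
Hypothesis fZ : forall z, Z z -> Z' (f z).
Hypothesis fB : forall z, Z z -> (B' (f z) <-> B z).

(** [f] induces an injection of Z/B into Z'/B', and the images of the [v i] already form a basis of
    the target. *)
Lemma basis_mod_lift n (v : 'I_n -> V) :
  (forall i, Z (v i)) -> basis_mod Z' B' (fun i => f (v i)) -> basis_mod Z B v.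
Proof.
move=> Zv [_ iv gv]; split=> // [a Ba|z Zz].
  by apply: iv; rewrite -linear_map_lin //; apply/fB => //; apply: subspace_lin.
have [a Ba] := gv _ (fZ Zz); exists a; apply/fB.
  by apply: subspaceB => //; apply: subspace_lin.
by rewrite linear_mapB // linear_map_lin.
Qed.

Hypothesis f_onto : forall w, Z' w -> exists2 z, Z z & f z = w.

Lemma basis_mod_push n (v : 'I_n -> V) :
  basis_mod Z B v -> basis_mod Z' B' (fun i => f (v i)).
Proof.
move=> [Zv iv gv]; split=> [i|a Ba|w /f_onto[z Zz <-]]; first exact/fZ/Zv.
  by apply: iv; apply/fB; [apply: subspace_lin | rewrite linear_map_lin].
have [a Ba] := gv _ Zz; exists a; rewrite -linear_map_lin // -linear_mapB //.
by apply/fB => //; apply: subspaceB => //; apply: subspace_lin.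
Qed.

Lemma dim_mod_push n : dim_mod Z B n -> dim_mod Z' B' n.
Proof. by move=> [v /basis_mod_push bv]; exists (fun i => f (v i)). Qed.

Lemma dim_mod_lift n : dim_mod Z' B' n -> dim_mod Z B n.
Proof.
move=> [w bw]; have [Zw _ _] := bw.
have [v Zv fv] := fin_all_exists2 (fun i => f_onto (Zw i)).
exists v; apply: basis_mod_lift => //.
case: bw => _ iw gw; split=> [i|a|z].
- by rewrite /= fv.
- under eq_bigr do rewrite /= fv; exact: iw.
- by move=> /gw[a Ba]; exists a; under eq_bigr do rewrite /= fv.
Qed.

End Transfer.

Lemma basis_mod_ext (V : lmodType k) (Z B Z' B' : V -> Prop) n (v : 'I_n -> V) :
  (forall z, Z z <-> Z' z) -> (forall z, B z <-> B' z) ->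
  basis_mod Z B v -> basis_mod Z' B' v.
Proof.
move=> eZ eB [Zv iv gv]; split=> [i|a|z].
- exact/eZ.
- by move=> /eB; apply: iv.
- by move=> /eZ /gv [a /eB Ba]; exists a.
Qed.

Lemma eq_basis_mod (V : lmodType k) (Z B : V -> Prop) n (v w : 'I_n -> V) :
  v =1 w -> basis_mod Z B v -> basis_mod Z B w.
Proof.
move=> vw [Zv iv gv]; split=> [i|a|z /gv [a]]; first by rewrite -vw.
  by under eq_bigr do rewrite -vw; apply: iv.
by under eq_bigr do rewrite vw; exists a.
Qed.

Lemma basis_mod_id (V : lmodType k) (Z B Z' B' : V -> Prop) n (v : 'I_n -> V) :
  subspace Z -> (forall z, Z z <-> Z' z) -> (forall z, Z z -> (B' z <-> B z)) ->
  basis_mod Z B v -> basis_mod Z' B' v.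
Proof.
move=> sZ eZ eB; apply: (basis_mod_push (f := idfun)) => // [z|w /eZ Zw].
  exact: (proj1 (eZ z)).
by exists w.
Qed.

Lemma dim_mod_id (V : lmodType k) (Z B Z' B' : V -> Prop) n :
  subspace Z -> (forall z, Z z <-> Z' z) -> (forall z, Z z -> (B' z <-> B z)) ->
  dim_mod Z B n -> dim_mod Z' B' n.
Proof. by move=> sZ eZ eB [v bv]; exists v; apply: basis_mod_id bv. Qed.

Lemma dim_mod_ext (V : lmodType k) (Z B Z' B' : V -> Prop) n :
  (forall z, Z z <-> Z' z) -> (forall z, B z <-> B' z) ->
  dim_mod Z B n -> dim_mod Z' B' n.
Proof. by move=> eZ eB [v bv]; exists v; apply: basis_mod_ext bv. Qed.

Lemma dim_mod_prod (V W : lmodType k) (P : V -> Prop) (Q : W -> Prop) n m :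
  subspace P -> subspace Q ->
  dim_mod P (fun z => z = 0) n -> dim_mod Q (fun z => z = 0) m ->
  dim_mod (fun z : V * W => P z.1 /\ Q z.2) (fun z => z = 0) (n + m).
Proof.
move=> sP sQ dP dQ.
have sZ : subspace (fun z : V * W => P z.1 /\ Q z.2).
  by split=> [|a u v [? ?] [? ?]]; split; do ?[exact: subspace0 | exact: sP.2 | exact: sQ.2].
have sPP : subspace (fun z : V * W => P z.1 /\ z.2 = 0).
  split=> [|a u v [? u0] [? v0]]; split=> //=; [exact: subspace0 | exact: sP.2|].
  by rewrite u0 v0 scaler0 addr0.
rewrite addnC.
have [v bv] : dim_mod (fun z : V * W => P z.1 /\ Q z.2) (fun z => P z.1 /\ z.2 = 0) m.
  apply: (dim_mod_lift (f := snd) (Z' := Q) (B' := fun z => z = 0)) dQ => //.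
  - by move=> z [].
  - by move=> z [Pz Qz]; split=> [|[]].
  - by move=> w Qw; exists (0, w) => //; split=> //; apply: subspace0.
have [w bw] : dim_mod (fun z : V * W => P z.1 /\ z.2 = 0) (fun z => z = 0) n.
  apply: (dim_mod_lift (f := fst) (Z' := P) (B' := fun z => z = 0)) dP => //.
  - by move=> z [].
  - by move=> [z1 z2] /= [Pz ->]; split=> [->|[]].
  - by move=> w Qw; exists (w, 0).
exists (catf v w); apply: basis_mod_cat bv bw => //.
- by move=> z ->; split=> //; apply: subspace0.
- by move=> z [? ->]; split=> //; apply: subspace0.
Qed.

(** A graded subquotient concentrated in degrees [p] and [q] is the sum of its two components. The
    grading is given by abstract projections [pi], so that one statement serves both the ideal in R
    and the syzygies in R^3. *)
Lemma basis_mod_graded (V : lmodType k) (pi : nat -> V -> V)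
    (Z B : V -> Prop) p q n m (v : 'I_n -> V) (w : 'I_m -> V) :
  (forall d, linear_map (pi d)) -> subspace Z -> subspace B -> p != q ->
  (forall d e z, pi d (pi e z) = if d == e then pi d z else 0) ->
  (forall z, exists N, z = \sum_(d < N) pi d z) ->
  (forall d z, Z z -> Z (pi d z)) -> (forall d z, B z -> B (pi d z)) ->
  (forall d z, d != p -> d != q -> Z z -> B (pi d z)) ->
  basis_mod (fun z => Z z /\ pi p z = z) B v ->
  basis_mod (fun z => Z z /\ pi q z = z) B w ->
  basis_mod Z B (catf v w).
Proof.
move=> lpi sZ sB pq piM piE Zpi Bpi ZB [Zv iv gv] [Zw iw gw].
have pi_ne d e z : pi e z = z -> d != e -> pi d z = 0.
  by move=> ez /negbTE de; rewrite -ez piM de.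
split.
- by apply: catf_ind => i; [case: (Zv i) | case: (Zw i)].
- move=> a; rewrite sum_catf => Ba; apply: all_split => i.
    apply: (iv (fun i => a (lshift m i))); have := Bpi p _ Ba.
    rewrite (linear_mapD (lpi p)) !(linear_map_lin (lpi p)).
    under eq_bigr do rewrite (proj2 (Zv _)).
    rewrite [X in _ + X]big1 ?addr0 // => j _.
    by rewrite (pi_ne _ q) ?scaler0 //; case: (Zw j).
  apply: (iw (fun i => a (rshift n i))); have := Bpi q _ Ba.
  rewrite (linear_mapD (lpi q)) !(linear_map_lin (lpi q)).
  under [X in _ + X]eq_bigr do rewrite (proj2 (Zw _)).
  rewrite [X in X + _]big1 ?add0r // => j _.
  by rewrite (pi_ne _ p) ?scaler0 1?eq_sym //; case: (Zv j).
- move=> z Zz.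
  have pi_id d : Z (pi d z) /\ pi d (pi d z) = pi d z.
    by split; [exact: Zpi | rewrite piM eqxx].
  have [a Ba] := gv _ (pi_id p); have [b Bb] := gw _ (pi_id q).
  exists (catf a b); rewrite sum_catf.
  under eq_bigr do rewrite catf_l.
  under [X in _ - (_ + X)]eq_bigr do rewrite catf_r.
  (* The remainder has no component in degrees [p] and [q], and its other components lie in [B]. *)
  have Bz : B (z - pi p z - pi q z).
    have [N ->] := piE (z - pi p z - pi q z).
    apply: (subspace_sum sB) => d; rewrite !(linear_mapB (lpi d)) !piM.
    have [->|dp] := eqVneq (d : nat) p.
      by rewrite (negbTE pq) subr0 subrr; apply: subspace0.
    have [dq|dq] := eqVneq (d : nat) q.
      by rewrite subr0 dq subrr; apply: subspace0.
    by rewrite !subr0; apply: ZB.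
  set x := \sum_i _ in Ba *; set y := \sum_i _ in Bb *.
  have -> : z - (x + y) = (z - pi p z - pi q z) + (pi p z - x) + (pi q z - y).
    by rewrite (addrAC (z - pi p z)) (addrA (z - pi p z)) subrK addrA subrK opprD addrA.
  by do 2![apply: subspaceD => //].
Qed.

Lemma scalar_sum (V : lmodType k) (psi : V -> k) n (a : 'I_n -> k) (v : 'I_n -> V) :
  scalar psi -> psi (\sum_i a i *: v i) = \sum_i a i * psi (v i).
Proof.
move=> lin; have psi0 : psi 0 = 0.
  by have := lin (-1) 0 0; rewrite scaler0 addr0 mulN1r addNr.
elim: n a v => [|n IHn] a v; first by rewrite !big_ord0.
by rewrite !big_ord_recl lin IHn.
Qed.

(** Finite-dimensional duality: a functional that vanishes on the left kernel of a pairing comes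
    from the right factor. In coordinates, a column annihilated by the left kernel of the matrix [G]
    lies in its column space. *)
Lemma functional_repr (V C : lmodType k) (PV : V -> Prop) (PC : C -> Prop)
    (gamma : V -> C -> k) (psi : V -> k) n m :
  subspace PC -> subspace PV ->
  (forall c, scalar (gamma^~ c)) -> (forall v, scalar (gamma v)) -> scalar psi ->
  dim_mod PV (fun z => z = 0) n -> dim_mod PC (fun z => z = 0) m ->
  (forall v, PV v -> (forall c, PC c -> gamma v c = 0) -> psi v = 0) ->
  exists2 c, PC c & forall v, PV v -> psi v = gamma v c.
Proof.
move=> sPC sPV lin_l lin_r lin_psi [v [Pv _ gv]] [c [Pc _ gc]] kill.
pose G := \matrix_(i < n, j < m) gamma (v i) (c j).
pose y := \col_(i < n) psi (v i).
have ker_y (r : 'rV_n) : r *m G = 0 -> r *m y = 0.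
  move=> /rowP rG; apply/rowP => l; rewrite mxE (ord1 l) mxE.
  under eq_bigr do rewrite mxE; rewrite -scalar_sum //.
  apply: kill => [|d /gc [a ad]]; first exact: subspace_lin.
  have -> : d = \sum_j a j *: c j by apply/eqP; rewrite -subr_eq0; apply/eqP.
  rewrite scalar_sum // big1 // => j _; apply/eqP; rewrite mulf_eq0; apply/orP; right.
  have := rG j; rewrite !mxE => <-; rewrite (scalar_sum _ _ (lin_l _)).
  by apply/eqP/eq_bigr => i _; rewrite mxE.
have /submxP [d yd] : (y^T <= G^T)%MS.
  rewrite submxE -[_ *m _]trmxK trmx_mul trmxK; apply/eqP.
  apply: (canLR (@trmxK _ _ _)); rewrite trmx0; apply/row_matrixP => i.
  rewrite row_mul ker_y ?row0 // -row_mul -[_ *m G]trmxK trmx_mul trmxK mulmx_coker.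
  by rewrite trmx0 row0.
exists (\sum_j d 0 j *: c j) => [|u /gv [a au]]; first exact: subspace_lin.
have -> : u = \sum_j a j *: v j by apply/eqP; rewrite -subr_eq0; apply/eqP.
rewrite scalar_sum // (scalar_sum _ _ (lin_l _)); apply: eq_bigr => i _.
congr (_ * _); rewrite scalar_sum //; have /rowP/(_ i) := yd; rewrite !mxE => ->.
by apply: eq_bigr => j _; rewrite !mxE.
Qed.

Lemma basis_mod_change (V : lmodType k) (Z B : V -> Prop) n (v : 'I_n -> V) (A : 'M_n) :
  subspace Z -> A \in unitmx -> basis_mod Z B v ->
  basis_mod Z B (fun i => \sum_j A i j *: v j).
Proof.
move=> sZ uA [Zv iv gv]; split=> [i|a|z /gv [a Ba]].
- exact: subspace_lin.
- pose c := \row_i a i.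
  under eq_bigr => i do have -> : a i = c 0 i by rewrite mxE.
  rewrite sum_mulmx => /iv cA i.
  have -> : a i = (c *m A *m invmx A) 0 i by rewrite mulmxK // mxE.
  suff -> : c *m A = 0 by rewrite mul0mx mxE.
  by apply/rowP => j; rewrite cA mxE.
- pose c := (\row_i a i) *m invmx A; exists (c 0).
  rewrite sum_mulmx mulmxKV //.
  by under eq_bigr do rewrite mxE.
Qed.

End Subspaces.

(** * The Koszul complex on three variables as vector calculus *)

Definition o0 : 'I_3 := @Ordinal 3 0 isT.
Definition o1 : 'I_3 := @Ordinal 3 1 isT.
Definition o2 : 'I_3 := @Ordinal 3 2 isT.

Lemma ord3_ind (Q : 'I_3 -> Prop) : Q o0 -> Q o1 -> Q o2 -> forall i, Q i.
Proof.
move=> q0 q1 q2 [[|[|[|//]]] lt_i]; [move: q0 | move: q1 | move: q2];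
  by congr (Q _); apply: val_inj.
Qed.

Lemma big_ord3 (T : Type) (idx : T) (op : Monoid.law idx) (F : 'I_3 -> T) :
  \big[op/idx]_(i < 3) F i = op (F o0) (op (F o1) (F o2)).
Proof.
rewrite !big_ord_recl big_ord0 Monoid.mulm1.
by congr (op (F _) (op (F _) (F _))); apply: val_inj.
Qed.

Section Koszul3.
Variable k : fieldType.
Local Notation R := {mpoly k[3]}.
Local Notation R3 := (R * R * R)%type.

Implicit Types (a b u : R3) (p q : R) (d : nat).

(* In three variables K_1 and K_2 are both R^3, exterior products are dot and
   cross products, and the Koszul differentials are, up to sign, the analogues of
   grad, curl and div with the partial derivatives replaced by the variables. *)
Definition dot a b : R := a.1.1 * b.1.1 + a.1.2 * b.1.2 + a.2 * b.2.

Definition cross a b : R3 :=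
  (a.1.2 * b.2 - a.2 * b.1.2, a.2 * b.1.1 - a.1.1 * b.2,
   a.1.1 * b.1.2 - a.1.2 * b.1.1).

Definition smul p a : R3 := (p * a.1.1, p * a.1.2, p * a.2).

Definition xvec : R3 := ('X_o0, 'X_o1, 'X_o2).
Definition div a : R := dot xvec a.
Definition curl a : R3 := cross xvec a.
Definition grad p : R3 := smul p xvec.

Lemma triple_eq a b : a.1.1 = b.1.1 -> a.1.2 = b.1.2 -> a.2 = b.2 -> a = b.
Proof. by move: a b => [[a0 a1] a2] [[b0 b1] b2] /= -> -> ->. Qed.

Definition all3 (P : R -> Prop) a := [/\ P a.1.1, P a.1.2 & P a.2].

Lemma all3_impl (P Q : R -> Prop) a : (forall p, P p -> Q p) -> all3 P a -> all3 Q a.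
Proof. by move=> PQ [? ? ?]; split; apply: PQ. Qed.

Lemma subspace_all3 (P : R -> Prop) : subspace P -> subspace (all3 P).
Proof.
move=> sP; split=> [|c u v [? ? ?] [? ? ?]]; first by split; apply: subspace0.
by split; apply: sP.2.
Qed.

Lemma dot_linear a : linear (dot a).
Proof. by move=> c u v; rewrite /dot /= -!mul_mpolyC; ring. Qed.
HB.instance Definition _ a := GRing.isLinear.Build k R3 R _ (dot a) (dot_linear a).

Lemma cross_linear a : linear (cross a).
Proof.
by move=> c u v; apply: triple_eq; rewrite /= -!mul_mpolyC; ring.
Qed.
HB.instance Definition _ a :=
  GRing.isLinear.Build k R3 R3 _ (cross a) (cross_linear a).

HB.instance Definition _ :=
  GRing.isLinear.Build k R3 R _ div (dot_linear xvec).
HB.instance Definition _ :=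
  GRing.isLinear.Build k R3 R3 _ curl (cross_linear xvec).

Lemma grad_linear : linear grad.
Proof.
by move=> c u v; apply: triple_eq; rewrite /= -!mul_mpolyC; ring.
Qed.
HB.instance Definition _ := GRing.isLinear.Build k R R3 _ grad grad_linear.

Lemma dotP a : linear_map (dot a). Proof. exact: dot_linear. Qed.
Lemma dotD a u v : dot a (u + v) = dot a u + dot a v. Proof. exact: (linearD (dot a)). Qed.
Lemma dotB a u v : dot a (u - v) = dot a u - dot a v. Proof. exact: (linearB (dot a)). Qed.
Lemma dotN a u : dot a (- u) = - dot a u. Proof. exact: (linearN (dot a)). Qed.
Lemma curlN u : curl (- u) = - curl u. Proof. exact: (linearN curl). Qed.
Lemma div0 : div 0 = 0. Proof. exact: (linear0 div). Qed.
Lemma divD u v : div (u + v) = div u + div v. Proof. exact: (linearD div). Qed.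
Lemma divB u v : div (u - v) = div u - div v. Proof. exact: (linearB div). Qed.
Lemma divP c u v : div (c *: u + v) = c *: div u + div v.
Proof. exact: (dot_linear xvec). Qed.
Lemma curl0 : curl 0 = 0. Proof. exact: (linear0 curl). Qed.
Lemma curlD u v : curl (u + v) = curl u + curl v. Proof. exact: (linearD curl). Qed.
Lemma curlB u v : curl (u - v) = curl u - curl v. Proof. exact: (linearB curl). Qed.
Lemma curlP c u v : curl (c *: u + v) = c *: curl u + curl v.
Proof. exact: (cross_linear xvec). Qed.
Lemma grad0 : grad 0 = 0. Proof. exact: (linear0 grad). Qed.
Lemma gradP c p q : grad (c *: p + q) = c *: grad p + grad q.
Proof. exact: grad_linear. Qed.

Lemma dotC a b : dot a b = dot b a. Proof. by rewrite /dot; ring. Qed.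
Lemma dot_linear_l b : linear_map (dot^~ b).
Proof. by move=> c u v; rewrite !(dotC _ b) dot_linear. Qed.
Lemma crossC a b : cross a b = - cross b a.
Proof. by apply: triple_eq; rewrite /=; ring. Qed.
Lemma dot_smull p a b : dot (smul p a) b = p * dot a b.
Proof. by rewrite /dot /=; ring. Qed.
Lemma dot_curl a b : dot a (curl b) = - dot (curl a) b.
Proof. by rewrite /dot /=; ring. Qed.
Lemma dot_grad p a : dot (grad p) a = p * div a.
Proof. exact: dot_smull. Qed.
Lemma div_curl a : div (curl a) = 0.
Proof. by rewrite /div /dot /=; ring. Qed.
Lemma curl_grad p : curl (grad p) = 0.
Proof. by apply: triple_eq; rewrite /=; ring. Qed.
Lemma grad_dot a b : grad (dot a b) = smul (div a) b + cross a (curl b).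
Proof. by apply: triple_eq; rewrite /= /div /dot /=; ring. Qed.
Lemma curl_cross a b : curl (cross a b) = smul (div b) a - smul (div a) b.
Proof. by apply: triple_eq; rewrite /= /div /dot /=; ring. Qed.
Lemma div_smul p a : div (smul p a) = p * div a.
Proof. by rewrite /div /dot /=; ring. Qed.

(** * Exactness of the Koszul complex on three variables *)

(** Substitution of 0 for one variable: reduction modulo ['X_i], with representatives taken in R
    itself so that divisibility can be tested there. *)
Definition drop_var (i : 'I_3) : R -> R :=
  comp_mpoly [tuple if j == i then 0 else 'X_j | j < 3].
HB.instance Definition _ i := GRing.RMorphism.on (drop_var i).

Lemma drop_varX i j : drop_var i 'X_j = if j == i then 0 else 'X_j.
Proof. by rewrite /drop_var comp_mpolyXU -tnth_nth tnth_mktuple. Qed.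

Lemma drop_varE i p : exists q, p = drop_var i p + 'X_i * q.
Proof.
pose Q p := exists q, p = drop_var i p + 'X_i * q.
have QC c : Q c%:MP by exists 0; rewrite mulr0 addr0 /drop_var comp_mpolyC.
have QD p1 p2 : Q p1 -> Q p2 -> Q (p1 + p2).
  by move=> [q1 e1] [q2 e2]; exists (q1 + q2); rewrite rmorphD {1}e1 {1}e2; ring.
have QM p1 p2 : Q p1 -> Q p2 -> Q (p1 * p2).
  move=> [q1 e1] [q2 e2]; exists (drop_var i p1 * q2 + q1 * p2).
  transitivity (drop_var i p1 * p2 + 'X_i * q1 * p2); first by rewrite -mulrDl -e1.
  by rewrite rmorphM {1}e2; ring.
have QX j : Q 'X_j.
  rewrite /Q drop_varX; case: eqP => [->|_]; first by exists 1; rewrite add0r mulr1.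
  by exists 0; rewrite mulr0 addr0.
apply: (mpolyind (P := Q)) => [|c m p' _ _ Qp]; first by rewrite -mpolyC0; apply: QC.
apply: QD => //; rewrite -mul_mpolyC; apply: (QM); first exact: QC.
rewrite mpolyXE_id; apply: (big_ind Q) => [|p1 p2|j _]; [by rewrite -mpolyC1 | exact: QM|].
by elim: (m j) => [|e IHe]; [rewrite expr0 -mpolyC1; apply: QC | rewrite exprS; apply: (QM)].
Qed.

Lemma X_neq0 i : 'X_i != 0 :> R.
Proof. by rewrite -msupp_eq0 msuppX. Qed.

Lemma X_inj i : injective (fun p : R => 'X_i * p).
Proof. exact: mulfI (X_neq0 i). Qed.

Lemma X_divides i j p q : j != i -> 'X_j * p = 'X_i * q -> exists r, p = 'X_i * r.
Proof.
move=> ji e; have [r pr] := drop_varE i p; exists r.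
suff p0 : drop_var i p = 0 by rewrite {1}pr p0 add0r.
have := congr1 (drop_var i) e; rewrite !rmorphM /= !drop_varX eqxx mul0r (negbTE ji).
by move/eqP; rewrite mulf_eq0 (negbTE (X_neq0 _)) => /eqP.
Qed.

Lemma curl_exact b : curl b = 0 -> exists c, b = grad c.
Proof.
move: b => [[b0 b1] b2] e.
have /eqP := congr1 (fun t => t.1.2) e; rewrite /= subr_eq0 => /eqP e1.
have /eqP := congr1 (fun t => t.2) e; rewrite /= subr_eq0 => /eqP e2.
have [c bc] := X_divides (isT : o1 != o0) (esym e2).
have cX j q : 'X_o0 * q = 'X_j * b0 -> q = c * 'X_j.
  by move=> eq; apply: (@X_inj o0); rewrite /= eq bc; ring.
by exists c; apply: triple_eq => /=; [rewrite bc mulrC | apply: cX | apply: cX].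
Qed.

(** Modulo X_0 the last two entries form a syzygy of X_1 and X_2, hence a multiple [d] of the Koszul
    relation. Together with the quotients [u] and [v] by X_0 this gives the potential; the first
    entry then agrees because X_0 can be cancelled. *)
Lemma div_exact a : div a = 0 -> exists b, a = curl b.
Proof.
move: a => [[a0 a1] a2]; rewrite /div /dot /= => e.
have [u a1E] := drop_varE o0 a1; have [v a2E] := drop_varE o0 a2.
have e12 : 'X_o1 * drop_var o0 a1 = 'X_o2 * - drop_var o0 a2.
  have := congr1 (drop_var o0) e; rewrite rmorph0 !rmorphD !rmorphM /= !drop_varX /= mul0r add0r.
  by move/eqP; rewrite addr_eq0 mulrN => /eqP.
have [d a1d] := X_divides (isT : o1 != o2) e12.
have a2d : drop_var o0 a2 = - 'X_o1 * d.
  by apply: (@X_inj o2); apply: oppr_inj; rewrite -mulrN -e12 a1d; ring.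
rewrite a1d in a1E; rewrite a2d in a2E.
exists (d, v, - u); apply: triple_eq => /=; [| by rewrite a1E; ring | by rewrite a2E; ring].
by apply: (@X_inj o0); apply/eqP; rewrite -subr_eq0; apply/eqP; rewrite -[RHS]e a1E a2E; ring.
Qed.

(** * Homogeneous components *)

Definition hcomp d : R -> R := pihomog mdeg d.
HB.instance Definition _ d := GRing.Linear.on (hcomp d).

Definition hcomp3 d a : R3 := (hcomp d a.1.1, hcomp d a.1.2, hcomp d a.2).

Lemma hcomp3_linear d : linear (hcomp3 d).
Proof. by move=> c u v; apply: triple_eq; rewrite /= linearP. Qed.
HB.instance Definition _ d := GRing.isLinear.Build k R3 R3 _ (hcomp3 d) (hcomp3_linear d).

Definition hdeg d p : Prop := p \is d.-homog.

Lemma subspace_hdeg d : subspace (hdeg d).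
Proof. by split=> [|c u v]; [exact: rpred0 | move=> ? ?; apply: rpredD => //; exact: rpredZ]. Qed.

Lemma hdeg_hcomp d p : hdeg d (hcomp d p).
Proof. exact: pihomogP. Qed.

Lemma hcomp_id d p : hdeg d p -> hcomp d p = p.
Proof. exact: pihomog_dE. Qed.

Lemma hcomp_ne d e p : hdeg e p -> e != d -> hcomp d p = 0.
Proof. by move=> hp ed; apply: pihomog_ne0 hp. Qed.

Lemma hcompM d e p : hcomp d (hcomp e p) = if d == e then hcomp d p else 0.
Proof.
case: eqP => [->|/eqP de]; first exact: (hcomp_id (hdeg_hcomp _ _)).
by apply: hcomp_ne (hdeg_hcomp e p) _; rewrite eq_sym.
Qed.

Lemma hcomp_sum p N : (mmeasure mdeg p <= N)%N -> p = \sum_(d < N) hcomp d p.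
Proof. exact: pihomog_partitionE. Qed.

Lemma hdegM d e p q : hdeg d p -> hdeg e q -> hdeg (d + e) (p * q).
Proof. exact: dhomogM. Qed.

Lemma hdegX i : hdeg 1 'X_i.
Proof. by rewrite /hdeg dhomogX /= mdeg1. Qed.

Lemma hdegXM i d p : hdeg d p -> hdeg d.+1 ('X_i * p).
Proof. by move=> hp; rewrite -add1n; apply: hdegM (hdegX i) hp. Qed.

Lemma hcompXM i d p : hcomp d.+1 ('X_i * p) = 'X_i * hcomp d p.
Proof.
rewrite {1}(hcomp_sum (leqnn _) (p := p)) mulr_sumr linear_sum /=.
rewrite [in RHS](hcomp_sum (leqnn _) (p := p)) linear_sum mulr_sumr.
apply: eq_bigr => e _; rewrite /= hcompM; case: eqP => [de|/eqP de].
  by rewrite de; apply/hcomp_id/hdegXM/hdeg_hcomp.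
rewrite mulr0; apply: hcomp_ne (hdegXM i (hdeg_hcomp _ _)) _.
by rewrite eqSS eq_sym.
Qed.

Lemma hcompXM0 i p : hcomp 0 ('X_i * p) = 0.
Proof.
rewrite (hcomp_sum (leqnn _) (p := p)) mulr_sumr linear_sum big1 // => e _ /=.
exact: hcomp_ne (hdegXM i (hdeg_hcomp _ _)) _.
Qed.

Lemma hcomp_div d a : hcomp d.+1 (div a) = div (hcomp3 d a).
Proof. by rewrite /div /dot !linearD /= !hcompXM. Qed.

Lemma hcomp_div0 a : hcomp 0 (div a) = 0.
Proof. by rewrite /div /dot !linearD /= !hcompXM0 !addr0. Qed.

Lemma hcomp_curl d a : hcomp3 d.+1 (curl a) = curl (hcomp3 d a).
Proof. by apply: triple_eq; rewrite /= linearB /= !hcompXM. Qed.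

Lemma hcomp_curl0 a : hcomp3 0 (curl a) = 0.
Proof. by apply: triple_eq; rewrite /= linearB /= !hcompXM0 subr0. Qed.

Lemma hcomp_grad d p : hcomp3 d.+1 (grad p) = grad (hcomp d p).
Proof. by apply: triple_eq; rewrite /= ![_ * 'X__]mulrC hcompXM. Qed.

Lemma hdeg3_hcomp d a : all3 (hdeg d) (hcomp3 d a).
Proof. by split; apply: hdeg_hcomp. Qed.

Lemma hcomp3_id d a : all3 (hdeg d) a -> hcomp3 d a = a.
Proof. by case=> ? ? ?; apply: triple_eq; apply: hcomp_id. Qed.

Lemma hcomp3M d e a : hcomp3 d (hcomp3 e a) = if d == e then hcomp3 d a else 0.
Proof. by rewrite /hcomp3 /= !hcompM; case: eqP. Qed.

Lemma hcomp3_sum a : exists N, a = \sum_(d < N) hcomp3 d a.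
Proof.
pose N := (mmeasure mdeg a.1.1 + mmeasure mdeg a.1.2 + mmeasure mdeg a.2)%N.
exists N; apply: triple_eq.
- rewrite (big_morph (fun t : R3 => t.1.1) (fun _ _ => erefl) erefl).
  by apply: hcomp_sum; rewrite /N; lia.
- rewrite (big_morph (fun t : R3 => t.1.2) (fun _ _ => erefl) erefl).
  by apply: hcomp_sum; rewrite /N; lia.
- rewrite (big_morph (fun t : R3 => t.2) (fun _ _ => erefl) erefl).
  by apply: hcomp_sum; rewrite /N; lia.
Qed.

Lemma hdeg3_div d a : all3 (hdeg d) a -> hdeg d.+1 (div a).
Proof.
move=> [? ? ?]; rewrite /div /dot.
by do 2?apply: subspaceD (@subspace_hdeg _) _ _ _ _; apply: hdegXM.
Qed.

Lemma hdeg3_curl d a : all3 (hdeg d) a -> all3 (hdeg d.+1) (curl a).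
Proof.
by move=> [? ? ?]; split; apply: subspaceB (@subspace_hdeg _) _ _ _ _; apply: hdegXM.
Qed.

Lemma hdeg3_grad d p : hdeg d p -> all3 (hdeg d.+1) (grad p).
Proof. by move=> hp; split; rewrite /= mulrC; apply: hdegXM. Qed.

Lemma hdeg_dot d e a b : all3 (hdeg d) a -> all3 (hdeg e) b -> hdeg (d + e) (dot a b).
Proof.
by move=> [? ? ?] [? ? ?]; do 2?apply: subspaceD (@subspace_hdeg _) _ _ _ _; apply: hdegM.
Qed.

Lemma hdeg_cross d e a b : all3 (hdeg d) a -> all3 (hdeg e) b -> all3 (hdeg (d + e)) (cross a b).
Proof.
by move=> [? ? ?] [? ? ?]; split; apply: subspaceB (@subspace_hdeg _) _ _ _ _; apply: hdegM.
Qed.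

Lemma div_exact_hdeg d a : all3 (hdeg d.+1) a -> div a = 0 ->
  exists2 b, all3 (hdeg d) b & a = curl b.
Proof.
move=> /hcomp3_id ha /div_exact[b ab]; exists (hcomp3 d b); first exact: hdeg3_hcomp.
by rewrite -hcomp_curl -ab ha.
Qed.

Lemma curl_exact_hdeg d b : all3 (hdeg d.+1) b -> curl b = 0 ->
  exists2 c, hdeg d c & b = grad c.
Proof.
move=> /hcomp3_id hb /curl_exact[c bc]; exists (hcomp d c); first exact: hdeg_hcomp.
by rewrite -hcomp_grad -bc hb.
Qed.

(** R = k + R_+, stated for inhomogeneous [p] because the coefficients of an arbitrary generating
    family are split in this way as well. *)
Lemma constant_or_div p : exists c a, p = c%:MP + div a.
Proof.
elim/mpolyind: p => [|c m p _ _ [c' [a ->]]].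
  by exists 0, 0; rewrite linear0 mpolyC0 addr0.
have [->|/eqP m0] := eqVneq m 0%MM.
  exists (c + c'), a; rewrite mpolyX0 -mul_mpolyC mpolyCD; ring.
have [i mi] : exists i, m i != 0%N.
  apply: not_all_not_ex => all0; apply: m0; apply/mnmP => i; rewrite mnm0E.
  by apply/eqP/negPn/negP/all0.
pose q : R := c *: 'X_[m - U_(i)].
have mE : c *: 'X_[m] = 'X_i * q.
  by rewrite -scalerAr -mpolyXD addmC submK // lep1mP.
exists c', ((if i == o0 then q else 0, if i == o1 then q else 0,
            if i == o2 then q else 0) + a).
rewrite linearD mE addrCA; congr (_ + (_ + _)).
by clearbody q; elim/ord3_ind: i {mi mE}; rewrite /= /div /dot /=; ring.
Qed.

Lemma hdeg_div d p : hdeg d.+1 p -> exists2 a, all3 (hdeg d) a & p = div a.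
Proof.
move=> /hcomp_id hp; have [c [a pE]] := constant_or_div p.
exists (hcomp3 d a); first exact: hdeg3_hcomp.
rewrite -hcomp_div -{1}hp pE linearD /=.
by rewrite (@hcomp_ne _ 0) ?add0r // /hdeg -alg_mpolyC; apply: rpredZ; apply: dhomog1.
Qed.

Lemma dim_hdeg d : dim_mod (hdeg d) (fun z => z = 0) 'C(d + 2, d).
Proof.
have dimE : \dim {: dhomog 3 k d} = 'C(d + 2, d) by rewrite dimvf.
rewrite -dimE; pose v := vbasis {: dhomog 3 k d}.
exists (fun i => mpoly_of_dhomog v`_i); split=> [i|a|z hz].
- exact: dhomog_is_dhomog.
- under eq_bigr do rewrite -linearZ.
  rewrite -linear_sum => z0; have /freeP fv := basis_free (vbasisP {: dhomog 3 k d}).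
  by apply: (fv); apply: val_inj; apply: z0.
- exists (coord v ^~ (DHomog hz)); under eq_bigr do rewrite -linearZ.
  by rewrite -linear_sum -(coord_vbasis (memvf _)) subrr.
Qed.

Lemma dim_all3 (P : R -> Prop) n : subspace P ->
  dim_mod P (fun z => z = 0) n -> dim_mod (all3 P) (fun z => z = 0) (3 * n).
Proof.
move=> sP dP.
have sPP : subspace (fun z : R * R => P z.1 /\ P z.2).
  by split=> [|c u v [? ?] [? ?]]; split; do ?[exact: subspace0 | exact: sP.2].
have := dim_mod_prod sPP sP (dim_mod_prod sP sP dP dP) dP.
have -> : (n + n + n = 3 * n)%N by lia.
by apply: dim_mod_ext => // z; split=> [[[]]|[]].
Qed.

End Koszul3.

(** Turns binomials into products, so that the dimension counts become polynomial arithmetic. *)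
Lemma bin_mul2 d : ('C(d + 2, d) * 2 = (d + 2) * (d + 1))%N.
Proof.
elim: d => [|d IHd]; first by rewrite bin0.
by rewrite addSn binS mulnDl IHd addn2 binSn; lia.
Qed.

(** * Duality with respect to the top socle degree *)

Section HomogeneousIdeal.
Variables (k : fieldType) (I : {pred {mpoly k[3]}}).
Hypothesis hI : homogeneous_ideal I.
Local Notation R := {mpoly k[3]}.
Local Notation R3 := (R * R * R)%type.
Implicit Types (a b u : R3) (p q : R) (d : nat).

Definition inI p : Prop := p \in I.
Definition idealdeg d p : Prop := hdeg d p /\ inI p.

Lemma subspace_inI : subspace inI.
Proof.
have [[I0 _ Iid] _] := hI; split=> // c p q Ip Iq.
by rewrite -mul_mpolyC; apply: Iid.
Qed.

Lemma inI_mul p q : inI q -> inI (p * q).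
Proof.
by have [[I0 _ Iid] _] := hI => Iq; rewrite -[_ * _]addr0; apply: Iid.
Qed.

Lemma inI_mulr p q : inI p -> inI (p * q).
Proof. by rewrite mulrC; apply: inI_mul. Qed.

Lemma inI_hcomp d p : inI p -> inI (hcomp d p).
Proof. by case: hI => _; apply. Qed.

Lemma inI_hcomp3 d a : all3 inI a -> all3 inI (hcomp3 d a).
Proof. by case=> ? ? ?; split; apply: inI_hcomp. Qed.

Lemma idealdeg3_hcomp d a : all3 inI a -> all3 (idealdeg d) (hcomp3 d a).
Proof. by case=> ? ? ?; split; (split; [exact: hdeg_hcomp | exact: inI_hcomp]). Qed.

Lemma inI_dot a u : all3 inI u -> inI (dot a u).
Proof.
by case=> ? ? ?; do 2?apply: (subspaceD subspace_inI); apply: inI_mul.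
Qed.

Lemma inI_cross a u : all3 inI u -> all3 inI (cross a u).
Proof.
by case=> ? ? ?; split; apply: (subspaceB subspace_inI); apply: inI_mul.
Qed.

Lemma inI_smul p a : inI p -> all3 inI (smul p a).
Proof. by move=> Ip; split; apply: inI_mulr. Qed.

Lemma subspace_inI3 : subspace (all3 inI).
Proof. exact: subspace_all3 subspace_inI. Qed.

Lemma subspace_idealdeg d : subspace (idealdeg d).
Proof.
split=> [|c u v [? ?] [? ?]].
  by split; apply: subspace0 => //; [exact: subspace_hdeg | exact: subspace_inI].
by split; [apply: (subspace_hdeg k d).2 | apply: subspace_inI.2].
Qed.

Lemma subspace_idealdeg3 d : subspace (all3 (idealdeg d)).
Proof. exact/subspace_all3/subspace_idealdeg. Qed.

Lemma idealdeg3P d a : all3 (idealdeg d) a <-> all3 (hdeg d) a /\ all3 inI a.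
Proof. by split=> [[[? ?] [? ?] [? ?]]|[[? ? ?] [? ? ?]]]. Qed.

Lemma dim_idealdeg d h : hilbert_fun I d h ->
  exists2 m, dim_mod (idealdeg d) (fun z => z = 0) m & 'C(d + 2, d) = (h + m)%N.
Proof.
move=> dh.
have [n [m [dn dm ->]]] : exists n m, [/\ dim_mod (hdeg d) (idealdeg d) n,
    dim_mod (idealdeg d) (fun z => z = 0) m & 'C(d + 2, d) = (n + m)%N].
  apply: dim_mod_split (dim_hdeg k d) => [||||z []//].
  - exact: subspace_hdeg.
  - exact: subspace_idealdeg.
  - exact: subspace_eq0.
  - by move=> z ->; apply: (subspace0 (subspace_idealdeg d)).
exists m => //; congr (_ + _)%N; apply: (dim_mod_uniq (subspace_idealdeg d) dn).
apply: (dim_mod_push (f := idfun) (Z := hdeg d) (B := inI)) dh => //.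
- exact: subspace_hdeg.
- by move=> z hz; split=> [[]|].
- by move=> w hw; exists w.
Qed.

Section Orthogonality.
Variables (e : nat) (tau : R).
Hypothesis tau_notin : ~ inI tau.
Hypothesis tau_top : forall p, hdeg e p -> exists c : k, inI (p - c *: tau).

Lemma tau_free (c : k) : inI (c *: tau) -> c = 0.
Proof.
move=> Ic; apply/eqP/negPn/negP => c0; apply: tau_notin.
by rewrite -[tau]scale1r -(mulVf c0) -scalerA; apply: (subspaceZ subspace_inI).
Qed.

(** The value at [p] is the coefficient of [tau] in the component of degree [e]. Passing to that
    component first defines it on all of R, and [tau_free] makes the coefficient unique, hence
    linear in [p]. *)
Lemma top_functional : exists2 phi : R -> k, scalar phi &
  (forall p, hdeg e p -> inI (p - phi p *: tau)).
Proof.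
have ex p : exists c : k, hcomp e p - c *: tau \in I by apply/tau_top/hdeg_hcomp.
exists (fun p => xchoose (ex p)) => [c p q|p hp]; last first.
  by rewrite -[X in inI (X - _)](hcomp_id hp); apply: (xchooseP (ex p)).
apply/eqP; rewrite -subr_eq0; apply/eqP/tau_free.
have := xchooseP (ex (c *: p + q)); have := xchooseP (ex p); have := xchooseP (ex q).
set x := xchoose _; set y := xchoose _; set z := xchoose _ => Ix Iy Iz.
have -> : (z - (c * y + x)) *: tau =
    c *: (hcomp e p - y *: tau) + (hcomp e q - x *: tau)
      - (hcomp e (c *: p + q) - z *: tau).
  by rewrite linearP /= -!mul_mpolyC mpolyCB mpolyCD mpolyCM; ring.
by apply: (subspaceB subspace_inI) => //; apply: subspace_inI.2.
Qed.

(** For [p] homogeneous of degree [d] this is membership in the Gorenstein ideal J. Homogeneity is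
    not part of the predicate and is always stated next to it. *)
Definition orth d p := forall q, hdeg (e - d) q -> inI (p * q).

Lemma orthXM d p i : (d < e)%N -> orth d p -> orth d.+1 ('X_i * p).
Proof.
move=> de Op q hq; rewrite mulrAC mulrC; apply: Op.
by have := hdegXM i hq; rewrite subnSK.
Qed.

Lemma orth3P d b : (d <= e)%N -> all3 (orth (e - d)) b <->
  (forall c, all3 (hdeg d) c -> inI (dot c b)).
Proof.
move=> de; rewrite /orth subKn //; split=> [[O0 O1 O2] c [? ? ?]|O].
  by do 2?apply: (subspaceD subspace_inI); rewrite mulrC; [apply: O0|apply: O1|apply: O2].
have h0 : hdeg d (0 : R) by exact: (subspace0 (subspace_hdeg k d)).
split=> q hq.
- by have := O (q, 0, 0) (And3 hq h0 h0); rewrite /dot /= !mul0r !addr0 mulrC.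
- by have := O (0, q, 0) (And3 h0 hq h0); rewrite /dot /= !mul0r addr0 add0r mulrC.
- by have := O (0, 0, q) (And3 h0 h0 hq); rewrite /dot /= !mul0r !add0r mulrC.
Qed.

Lemma dim_all3_hdeg d : dim_mod (all3 (@hdeg k d)) (fun z => z = 0) (3 * 'C(d + 2, d)).
Proof. by apply: dim_all3; [exact: subspace_hdeg | exact: dim_hdeg]. Qed.

(* The functional [b |-> a . b] vanishes on the [b] with [curl b] orthogonal to
   everything, hence it is of the form [b |-> c . curl b]. *)
Lemma curl_duality d a : (d < e)%N -> all3 (hdeg d.+1) a ->
  (forall b, all3 (hdeg (e - d.+1)) b -> all3 (orth (e - d)) (curl b) -> inI (dot a b)) ->
  exists2 c, all3 (hdeg d) c & all3 (orth d.+1) (a - curl c).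
Proof.
move=> de ha kill; have [phi lin phiE] := top_functional.
have phi0 p : hdeg e p -> phi p = 0 <-> inI p.
  move=> hp; have Ip := phiE p hp; split=> [p0|Hp].
    by move: Ip; rewrite p0 scale0r subr0.
  apply: tau_free; rewrite -[_ *: _](subKr p).
  exact: (subspaceB subspace_inI).
have hcurl b c : all3 (hdeg (e - d.+1)) b -> all3 (hdeg d) c -> hdeg e (dot c (curl b)).
  by move=> hb hc; have := hdeg_dot hc (hdeg3_curl hb); congr hdeg; lia.
have hdot b : all3 (hdeg (e - d.+1)) b -> hdeg e (dot a b).
  by move=> hb; have := hdeg_dot ha hb; congr hdeg; lia.
have [c hc cE] : exists2 c, all3 (hdeg d) c &
    forall b, all3 (hdeg (e - d.+1)) b -> phi (dot a b) = phi (dot c (curl b)).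
  apply: (functional_repr (gamma := fun b c => phi (dot c (curl b)))
    (psi := fun b => phi (dot a b)) _ _ _ _ _ (dim_all3_hdeg _) (dim_all3_hdeg _)).
  - exact: subspace_all3 (@subspace_hdeg k _).
  - exact: subspace_all3 (@subspace_hdeg k _).
  - by move=> c t u v; rewrite curlP dot_linear lin.
  - by move=> b t u v; rewrite !(dotC _ (curl b)) dot_linear lin.
  - by move=> t u v; rewrite dot_linear lin.
  - move=> b hb Ob; apply/phi0; first exact: hdot.
    apply: kill => //; apply/orth3P; first by lia.
    by move=> c hc; apply/phi0; [exact: hcurl | exact: Ob].
(* [dot_curl]: moving [curl] to the other factor changes the sign. *)
exists (- c); first exact: (subspaceN (subspace_all3 (@subspace_hdeg k _))).
rewrite -(subKn de); apply/orth3P; first by lia.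
move=> b hb; rewrite dotB curlN dotN opprK.
apply/phi0.
  apply: (subspaceD (subspace_hdeg k e)); first by rewrite dotC; exact: hdot.
  by have := hdeg_dot hb (hdeg3_curl hc); congr hdeg; lia.
rewrite -[dot b a]scale1r lin mul1r dotC cE // -[phi _]mul1r -lin scale1r.
rewrite dot_curl (dotC b) addNr; apply/phi0; apply: subspace0.
  exact: subspace_hdeg.
exact: subspace_inI.
Qed.

(** The analogue of [curl_duality] for the adjoint pair [div] and [grad]: the functional sending [a]
    to a . b is represented as c * div a, which equals grad c . a, this time without a sign. *)
Lemma grad_duality d b : (d < e)%N -> all3 (hdeg d.+1) b ->
  (forall a, all3 (hdeg (e - d.+1)) a -> orth (e - d) (div a) -> inI (dot a b)) ->
  exists2 c, hdeg d c & all3 (orth d.+1) (b - grad c).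
Proof.
move=> de hb kill; have [phi lin phiE] := top_functional.
have phi0 p : hdeg e p -> phi p = 0 <-> inI p.
  move=> hp; have Ip := phiE p hp; split=> [p0|Hp].
    by move: Ip; rewrite p0 scale0r subr0.
  apply: tau_free; rewrite -[_ *: _](subKr p).
  exact: (subspaceB subspace_inI).
have hdiv a c : all3 (hdeg (e - d.+1)) a -> hdeg d c -> hdeg e (c * div a).
  by move=> ha hc; have := hdegM hc (hdeg3_div ha); congr hdeg; lia.
have hdot a : all3 (hdeg (e - d.+1)) a -> hdeg e (dot a b).
  by move=> ha; have := hdeg_dot ha hb; congr hdeg; lia.
have [c hc cE] : exists2 c, hdeg d c &
    forall a, all3 (hdeg (e - d.+1)) a -> phi (dot a b) = phi (c * div a).
  apply: (functional_repr (gamma := fun a c => phi (c * div a))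
    (psi := fun a => phi (dot a b)) _ _ _ _ _ (dim_all3_hdeg _) (dim_hdeg k d)).
  - exact: subspace_hdeg.
  - exact: subspace_all3 (@subspace_hdeg k _).
  - by move=> c t u v; rewrite divP mulrDr -scalerAr lin.
  - by move=> a t u v; rewrite mulrDl -scalerAl lin.
  - by move=> t u v; rewrite !(dotC _ b) dot_linear lin.
  - move=> a ha Oa; apply/phi0; first exact: hdot.
    apply: kill => // q; rewrite subKn ?(ltnW de) // mulrC => hq.
    by apply/phi0; [exact: hdiv | exact: Oa].
exists c => //; rewrite -(subKn de); apply/orth3P; first by lia.
move=> a ha; rewrite dotB (dotC a (grad c)) dot_grad; apply/phi0.
  by apply: (subspaceB (subspace_hdeg k e)); [exact: hdot | exact: hdiv].
by rewrite addrC -scaleN1r lin cE //; ring.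
Qed.

End Orthogonality.

End HomogeneousIdeal.

(* [div] and [curl] shift the resolution by one step: Tor_1(R/I, k) = I / R_+ I,
   and Tor_2(R/I, k) is the first homology of the Koszul complex of I. *)
Section TorTriples.
Variables (k : fieldType) (I : {pred {mpoly k[3]}}).
Local Notation R := {mpoly k[3]}.
Local Notation R3 := (R * R * R)%type.
Local Notation inI := (inI I).
Implicit Types (a b u : R3) (p q : R).

Definition tor1_cycle a := inI (div a).
Definition tor1_zero a := exists b, exists2 u, all3 inI u & a = curl b + u.
Definition tor2_cycle b := all3 inI (curl b).
Definition tor2_zero b := exists c, exists2 u, all3 inI u & b = grad c + u.

Definition div_ideal p := exists2 u, all3 inI u & p = div u.
Definition syzygy u := all3 inI u /\ div u = 0.
Definition curl_ideal u := exists2 w, all3 inI w & u = curl w.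

Hypothesis hI : homogeneous_ideal I.

Let sI := subspace_inI hI.
Let sI3 := subspace_inI3 hI.

Lemma subspace_tor1_cycle : subspace tor1_cycle.
Proof.
split=> [|c u v Iu Iv]; first by rewrite /tor1_cycle div0; apply: subspace0.
by rewrite /tor1_cycle divP; apply: sI.2.
Qed.

Lemma subspace_tor2_cycle : subspace tor2_cycle.
Proof.
split=> [|c u v Iu Iv]; first by rewrite /tor2_cycle curl0; apply: subspace0.
by rewrite /tor2_cycle curlP; apply: sI3.2.
Qed.

Lemma subspace_tor2_zero : subspace tor2_zero.
Proof.
split=> [|c _ _ [p [u Iu ->]] [q [v Iv ->]]].
  by exists 0, 0; [apply: subspace0 | rewrite grad0 addr0].
exists (c *: p + q), (c *: u + v); first exact: sI3.2.
by rewrite gradP scalerDr addrACA.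
Qed.

Lemma subspace_syzygy : subspace syzygy.
Proof.
split=> [|c u v [Iu u0] [Iv v0]]; first by split; [apply: subspace0 | rewrite div0].
by split; [apply: sI3.2 | rewrite divP u0 v0 scaler0 addr0].
Qed.

Lemma subspace_div_ideal : subspace div_ideal.
Proof.
split=> [|c _ _ [u Iu ->] [v Iv ->]].
  by exists 0; [apply: subspace0 | rewrite div0].
by exists (c *: u + v); [apply: sI3.2 | rewrite divP].
Qed.

Lemma subspace_curl_ideal : subspace curl_ideal.
Proof.
split=> [|c _ _ [u Iu ->] [v Iv ->]].
  by exists 0; [apply: subspace0 | rewrite curl0].
by exists (c *: u + v); [apply: sI3.2 | rewrite curlP].
Qed.

(** If div a = div u with [u] in I^3, then a - u has divergence zero and is a curl; so [div] is
    injective from Tor_1 to I / R_+ I. *)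
Lemma div_idealP a : div_ideal (div a) <-> tor1_zero a.
Proof.
split=> [[u Iu au]|[b [u Iu ->]]]; last first.
  by exists u => //; rewrite divD div_curl add0r.
have [|b bE] := @div_exact _ (a - u); first by rewrite divB -au subrr.
by exists b, u => //; rewrite -bE subrK.
Qed.

Lemma curl_idealP b : curl_ideal (curl b) <-> tor2_zero b.
Proof.
split=> [[u Iu bu]|[c [u Iu ->]]]; last first.
  by exists u => //; rewrite curlD curl_grad add0r.
have [|c cE] := @curl_exact _ (b - u); first by rewrite curlB -bu subrr.
by exists c, u => //; rewrite -cE subrK.
Qed.

Lemma basis_tor1 n (v : 'I_n -> R3) :
  basis_mod inI div_ideal (fun i => div (v i)) -> basis_mod tor1_cycle tor1_zero v.
Proof.
move=> bv; have [Zv _ _] := bv.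
apply: (basis_mod_lift (f := @div k) (Z' := inI) (B' := div_ideal)) bv => //.
- exact: divP.
- exact: subspace_tor1_cycle.
- by move=> a _; apply: div_idealP.
Qed.

Lemma basis_tor2 n (v : 'I_n -> R3) :
  basis_mod syzygy curl_ideal (fun i => curl (v i)) -> basis_mod tor2_cycle tor2_zero v.
Proof.
move=> bv; have [Zv _ _] := bv.
apply: (basis_mod_lift (f := @curl k) (Z' := syzygy) (B' := curl_ideal)) bv => //.
- exact: curlP.
- exact: subspace_tor2_cycle.
- by move=> b; split=> //; apply: div_curl.
- by move=> b _; apply: curl_idealP.
- by move=> i; case: (Zv i).
Qed.

(** By the Leibniz rule [grad_dot], the multiples of a . b by the variables are the entries of (div
    a) b + a x curl b, where [div a] and [curl b] are in I. *)
Lemma socle_dot a b : tor1_cycle a -> tor2_cycle b -> socle I (dot a b).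
Proof.
move=> Ia Ib; have : all3 inI (grad (dot a b)).
  rewrite grad_dot; apply: (subspaceD sI3); first exact: (inI_smul hI).
  exact: (inI_cross hI).
by move=> [? ? ?] i; rewrite mulrC; elim/ord3_ind: i.
Qed.

(** Together with [inI_zero_dot] this makes the product of Tor_1 and Tor_2 well defined on
    classes. *)
Lemma inI_dot_zero a b : tor1_cycle a -> tor2_zero b -> inI (dot a b).
Proof.
move=> Ia [c [u Iu ->]]; rewrite dotD; apply: (subspaceD sI).
  by rewrite dotC dot_grad; apply: (inI_mul hI).
exact: (inI_dot hI).
Qed.

Lemma inI_zero_dot a b : tor1_zero a -> tor2_cycle b -> inI (dot a b).
Proof.
move=> [c [u Iu ->]] Ib; rewrite dotC dotD; apply: (subspaceD sI).
  by rewrite dotC -[dot _ _]opprK -dot_curl; apply/(subspaceN sI)/(inI_dot hI).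
exact: (inI_dot hI).
Qed.

Lemma inI_dot_basis_l n (v : 'I_n -> R3) a b :
  basis_mod tor1_cycle tor1_zero v -> (forall i, inI (dot (v i) b)) ->
  tor1_cycle a -> tor2_cycle b -> inI (dot a b).
Proof.
move=> [_ _ gv] vb Ia Ib; have [c Bc] := gv _ Ia.
rewrite -[a](subrK (\sum_i c i *: v i)) (linear_mapD (dot_linear_l b)).
rewrite (linear_map_lin (dot_linear_l b)).
by apply: (subspaceD sI); [exact: inI_zero_dot | exact: subspace_lin].
Qed.

Lemma inI_dot_basis_r n (v : 'I_n -> R3) a b :
  basis_mod tor2_cycle tor2_zero v -> (forall i, inI (dot a (v i))) ->
  tor1_cycle a -> tor2_cycle b -> inI (dot a b).
Proof.
move=> [_ _ gv] va Ia Ib; have [c Bc] := gv _ Ib.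
rewrite -[b](subrK (\sum_i c i *: v i)) dotD (linear_map_lin (dotP a)).
by apply: (subspaceD sI); [exact: inI_dot_zero | exact: subspace_lin].
Qed.

End TorTriples.

(** * The compressed case *)

(* Here s = r.+1, and e = 2s - 1 is the top socle degree. *)
Section Compressed.
Variables (k : fieldType) (I : {pred {mpoly k[3]}}) (r : nat).
Hypotheses (hI : homogeneous_ideal I) (r_ge2 : (2 <= r)%N).
Local Notation R := {mpoly k[3]}.
Local Notation R3 := (R * R * R)%type.
Local Notation inI := (inI I).
Local Notation idealdeg := (idealdeg I).
Local Notation e := (2 * r + 1)%N.
Local Notation orth := (orth I e).
Implicit Types (a b u : R3) (p q : R) (d : nat).

Variables sigma tau : R.
Hypotheses (sigma_deg : hdeg r.+1 sigma) (tau_deg : hdeg e tau).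
Hypotheses (sigma_socle : socle I sigma) (tau_socle : socle I tau).
Hypothesis socle_free : forall x y : k, inI (x *: sigma + y *: tau) -> x = 0 /\ y = 0.
Hypothesis socle_span : forall p, socle I p ->
  exists x y : k, inI (p - (x *: sigma + y *: tau)).

(** * The socle in each degree *)

Lemma r_neq_e : r.+1 != e. Proof. by apply/eqP; lia. Qed.

Lemma socle_hdeg d p : hdeg d p -> socle I p ->
  exists x y : k, inI (p - ((if d == r.+1 then x else 0) *: sigma
                            + (if d == e then y else 0) *: tau)).
Proof.
move=> hp /socle_span [x [y Ixy]]; exists x, y.
have := inI_hcomp hI d Ixy.
rewrite !linearB linearD !linearZ /= hcomp_id //.
have -> : x *: hcomp d sigma = (if d == r.+1 then x else 0) *: sigma.
  case: eqP => [->|/eqP ne]; first by rewrite hcomp_id.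
  by rewrite (hcomp_ne sigma_deg) ?scaler0 ?scale0r // eq_sym.
have -> // : y *: hcomp d tau = (if d == e then y else 0) *: tau.
case: eqP => [->|/eqP ne]; first by rewrite hcomp_id.
by rewrite (hcomp_ne tau_deg) ?scaler0 ?scale0r // eq_sym.
Qed.

Lemma sigma_free (x : k) : inI (x *: sigma) -> x = 0.
Proof.
move=> Ix; have [] // : x = 0 /\ (0 : k) = 0.
by apply: socle_free; rewrite scale0r addr0.
Qed.

Lemma tau_notin : ~ inI tau.
Proof.
move=> It; have [|_ /eqP] := @socle_free 0 1.
  by rewrite scale0r add0r scale1r.
by rewrite oner_eq0.
Qed.

Lemma socle_other d p : d != r.+1 -> d != e -> hdeg d p -> socle I p -> inI p.
Proof.
move=> /negbTE ds /negbTE de hp /(socle_hdeg hp) [x [y]].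
by rewrite ds de !scale0r addr0 subr0.
Qed.

Lemma socle_sigma p : hdeg r.+1 p -> socle I p -> exists x : k, inI (p - x *: sigma).
Proof.
move=> hp /(socle_hdeg hp) [x [y]]; rewrite eqxx (negbTE r_neq_e) scale0r addr0.
by exists x.
Qed.

Lemma socle_dims d : socle_dim I d ((d == r.+1) + (d == e))%N.
Proof.
have fn0 (T : Type) : 'I_0 -> T by case.
have [->|ds] := eqVneq d r.+1.
  rewrite (negbTE r_neq_e); exists (fun _ => sigma); split => [//|x|p [hp sp]].
    by rewrite big_ord1 => /sigma_free x0 i; rewrite (ord1 i).
  by have [x Ix] := socle_sigma hp sp; exists (fun _ => x); rewrite big_ord1.
have [dE|de] := eqVneq d e.
  exists (fun _ => tau); split => [_|x|p [hp sp]]; first by rewrite dE.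
    rewrite big_ord1 => /(tau_free hI tau_notin) x0 i; by rewrite (ord1 i).
  have [x [y]] := socle_hdeg hp sp; rewrite (negbTE ds) dE eqxx scale0r add0r.
  by exists (fun _ => y); rewrite big_ord1.
exists (fn0 _); split => [[]//|x _ []//|p [hp sp]].
by exists (fn0 _); rewrite big_ord0 subr0; apply: socle_other hp sp.
Qed.

(** * Dimensions of the ideal from the Hilbert function *)

Hypothesis hcompr : compressed I e.

(** [compressed] only provides some family of socle dimensions. Uniqueness of dimension identifies
    it with the indicator of the degrees s and e, and the sum collapses to at most two terms. *)
Lemma hilbert_compressed d : (d <= e)%N ->
  hilbert_fun I d (minn 'C(d + 2, d)
    ((if (d <= r.+1)%N then 'C(r.+1 - d + 2, r.+1 - d) else 0) + 'C(e - d + 2, e - d)))%N.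
Proof.
move=> de; have [c cE hil] := hcompr; have := hil d de.
have cE' l : c l = ((l == r.+1) + (l == e))%N.
  exact: (dim_mod_uniq (subspace_inI hI) (cE l) (socle_dims l)).
have -> : (\sum_(d <= l < e.+1) c l * 'C(2 + (l - d), l - d) =
    \sum_(d <= l < e.+1 | l == r.+1) 'C(l - d + 2, l - d) +
    \sum_(d <= l < e.+1 | l == e) 'C(l - d + 2, l - d))%N.
  transitivity (\sum_(d <= l < e.+1) ((l == r.+1) * 'C(l - d + 2, l - d)
      + (l == e) * 'C(l - d + 2, l - d)))%N.
    by apply: eq_bigr => l _; rewrite cE' (addnC 2%N) mulnDl.
  rewrite big_split /=; congr (_ + _)%N; rewrite [RHS]big_mkcond;
    by apply: eq_bigr => l _; case: eqP; rewrite ?mul1n ?mul0n.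
rewrite !big_nat1_eq de ltnSn /= (addnC 2%N).
have -> : (r.+1 < e.+1)%N by lia.
by rewrite andbT.
Qed.

(** For d < s one has e - d >= d, so the term of [tau] alone is at least dim R_d, and the minimum is
    dim R_d. *)
Lemma idealdeg_low d p : (d <= r)%N -> hdeg d p -> inI p -> p = 0.
Proof.
move=> dr hp Ip; have de : (d <= e)%N by lia.
have [m dm] := dim_idealdeg hI (hilbert_compressed de).
have -> : (d <= r.+1)%N by lia.
have := bin_mul2 d; have := bin_mul2 (r.+1 - d); have := bin_mul2 (e - d).
set x := 'C(_, _); set y := 'C(_, _); set z := 'C(_, _) => Ex Ey Ez zE.
have m0 : m = 0%N by nia.
move: dm; rewrite m0 => -[v [_ _ /(_ p (conj hp Ip)) [c]]].
by rewrite big_ord0 subr0.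
Qed.

(** In degree s the minimum is 1 + C(s+1, 2), the 1 coming from [sigma], while dim R_s = C(s+2, 2);
    the difference is s. *)
Lemma dim_idealdeg_init : dim_mod (idealdeg r.+1) (fun z => z = 0) r.+1.
Proof.
have de : (r.+1 <= e)%N by lia.
have [m dm] := dim_idealdeg hI (hilbert_compressed de).
have -> : (e - r.+1 = r)%N by lia.
rewrite leqnn subnn bin0.
have := bin_mul2 r.+1; have := bin_mul2 r.
set x := 'C(_, _); set z := 'C(_, _) => Ex Ez zE.
suff mE : m = r.+1 by move: dm; rewrite mE.
nia.
Qed.

(** Past degree s only [tau] contributes, and its term is the minimum since e - d < d. The equation
    is doubled to be free of binomials. *)
Lemma dim_idealdeg_above d : (r.+1 < d <= e)%N -> exists2 m,
  dim_mod (idealdeg d) (fun z => z = 0) m &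
  (2 * m + (e - d + 2) * (e - d + 1) = (d + 2) * (d + 1))%N.
Proof.
move=> /andP[rd de]; have [m dm] := dim_idealdeg hI (hilbert_compressed de).
rewrite leqNgt rd /=; have := bin_mul2 d; have := bin_mul2 (e - d).
set x := 'C(_, _); set z := 'C(_, _) => Ex Ez zE.
by exists m => //; nia.
Qed.

(** The value is C(s+3, 2) - C(s, 2). *)
Lemma dim_idealdeg_s1 : dim_mod (idealdeg r.+2) (fun z => z = 0) (3 * r.+1 + 3).
Proof.
have [|m dm mE] := @dim_idealdeg_above r.+2; first by lia.
suff -> : (3 * r.+1 + 3)%N = m by [].
have er : (e - r.+2 = r.-1)%N by lia.
by rewrite er in mE; nia.
Qed.

(** The value is C(s+4, 2) - C(s-1, 2). The formula is available because s + 2 <= e, which is the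
    condition s >= 3. *)
Lemma dim_idealdeg_s2 : dim_mod (idealdeg r.+3) (fun z => z = 0) (5 * r.+1 + 5).
Proof.
have [|m dm mE] := @dim_idealdeg_above r.+3; first by lia.
suff -> : (5 * r.+1 + 5)%N = m by [].
have er : (e - r.+3 = r - 2)%N by lia.
by rewrite er in mE; nia.
Qed.

(** * Orthogonality to the complementary degree *)

Lemma tau_top p : hdeg e p -> exists x : k, inI (p - x *: tau).
Proof.
have [] : hilbert_fun I e 1.
  have := hilbert_compressed (leqnn e); have -> : (e <= r.+1)%N = false by lia.
  by rewrite subnn bin0 add0n (minn_idPr _) // bin_gt0 leq_addr.
have sI := subspace_inI hI.
move=> v [_ _ gv] hp; have [c] := gv _ hp; have [c'] := gv _ tau_deg.
rewrite !big_ord1; set x := c 0; set y := c' 0 => Iy Ix.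
have y0 : y != 0.
  apply/eqP => y0; apply: tau_notin; move: Iy.
  by rewrite y0 scale0r subr0.
exists (x / y).
have -> : p - (x / y) *: tau = (p - x *: v 0) - (x / y) *: (tau - y *: v 0).
  by rewrite scalerBr scalerA mulfVK // opprB addrA subrK.
by apply: subspaceB => //; apply: subspaceZ.
Qed.

(** R_(e+1) consists of combinations of variables with coefficients in R_e, which is k tau modulo I,
    and the variables kill [tau] modulo I. *)
Lemma inI_above d p : (e < d)%N -> hdeg d p -> inI p.
Proof.
have sI := subspace_inI hI.
elim: d p => // d IHd p; rewrite ltnS leq_eqVlt => /orP[/eqP <-|ed] /hdeg_div[a [a0 a1 a2] ->].
  have Xa i q : hdeg e q -> inI ('X_i * q).
    move=> /tau_top [x Ix]; rewrite -[q](subrK (x *: tau)) mulrDr -scalerAr.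
    apply: (subspaceD sI); first exact: (inI_mul hI).
    by apply: (subspaceZ sI); apply: tau_socle.
  by do 2?apply: (subspaceD sI); apply: Xa.
by apply: (inI_dot hI); split; apply: IHd.
Qed.

(** Descending induction from degree e, where the test form 1 suffices. Below it the induction
    hypothesis puts every ['X_i * p] in I, so [p] is in the socle of R/I, which is zero strictly
    between s and e. *)
Lemma orth_high d p : (r.+1 < d)%N -> (d <= e)%N -> hdeg d p -> orth d p -> inI p.
Proof.
move=> rd de; move En: (e - d)%N => n; elim: n d En rd de p => [|n IHn] d En rd de p hp Op.
  rewrite -[p]mulr1; apply: Op.
  by rewrite En; apply: dhomog1.
apply: (@socle_other d) => //; [by apply/eqP; lia | by apply/eqP; lia|].
move=> i; apply: (IHn d.+1) => //; [lia | lia | lia | exact: hdegXM |].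
by apply: orthXM Op; lia.
Qed.

(* The socle forces the left kernel of the pairing of (R/I)_s with R_{s-1} to be
   the line spanned by [sigma]; as dim (R/I)_s = dim R_{s-1} + 1, there is no
   right kernel. *)
Lemma orth_mid p : hdeg r p -> orth r p -> p = 0.
Proof.
set N := 'C(r + 2, r) => hp Op; have sI := subspace_inI hI.
have [phi lin phiE] := top_functional hI tau_notin tau_top.
have phi0 q : hdeg e q -> phi q = 0 <-> inI q.
  move=> hq; have Iq := phiE q hq; split=> [q0|Hq].
    by move: Iq; rewrite q0 scale0r subr0.
  apply: (tau_free hI tau_notin); rewrite -[_ *: _](subKr q).
  exact: subspaceB.
have [u [hu iu gu]] : dim_mod (@hdeg k r.+1) inI N.+1.
  have [|] := hilbert_compressed (_ : r.+1 <= e)%N; first by lia.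
  have -> : (e - r.+1 = r)%N by lia.
  rewrite leqnn subnn bin0 add1n (minn_idPr _); first by move=> u bu; exists u.
  have := bin_mul2 r.+1; have := bin_mul2 r; rewrite -/N.
  set x := 'C(_, _); nia.
have [w [hw _ gw]] := dim_hdeg k r; rewrite -/N in w hw gw.
pose G := \matrix_(i < N.+1, j < N) phi (u i * w j).
have hprod p1 q1 : hdeg r.+1 p1 -> hdeg r q1 -> hdeg e (p1 * q1).
  by move=> hp1 hq1; have := hdegM hp1 hq1; congr hdeg; lia.
have [delta Idelta] := gu _ sigma_deg.
have kerG (c : 'rV_N.+1) : c *m G = 0 -> exists x : k, c = x *: \row_i delta i.
  move=> cG; pose q := \sum_i c 0 i *: u i.
  have hq : hdeg r.+1 q by apply: (subspace_lin (subspace_hdeg _ _)).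
  have qw j : inI (q * w j).
    apply/phi0; first exact: hprod.
    have /rowP/(_ j) := cG; rewrite !mxE => <-; rewrite mulr_suml.
    under eq_bigr do rewrite -scalerAl.
    by rewrite scalar_sum //; apply: eq_bigr => i _; rewrite mxE.
  have Oq q' : hdeg r q' -> inI (q * q').
    move=> /gw [a /eqP]; rewrite subr_eq0 => /eqP ->; rewrite mulr_sumr.
    by under eq_bigr do rewrite -scalerAr; apply: subspace_lin.
  have /(socle_sigma hq) [x Ix] : socle I q.
    move=> i; apply: (@orth_high r.+2) => //; [lia | exact: hdegXM |].
    move=> q' hq'; rewrite mulrAC mulrC; apply: Oq.
    by have := hdegXM i hq'; congr hdeg; lia.
  exists x; apply/rowP => i; rewrite !mxE; apply/eqP; rewrite -subr_eq0; apply/eqP.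
  apply: (iu (fun i => c 0 i - x * delta i)).
  have -> : \sum_i (c 0 i - x * delta i) *: u i =
      (q - x *: sigma) + x *: (sigma - \sum_i delta i *: u i).
    rewrite scalerBr addrA subrK scaler_sumr -sumrB.
    by apply: eq_bigr => j _; rewrite scalerBl scalerA.
  by apply: subspaceD => //; apply: subspaceZ.
(* The left kernel has dimension at most 1, so [G], with N + 1 rows, has rank at least N, its number
   of columns. *)
have /row_fullP [B BG] : row_full G.
  have : (kermx G <= \row_i delta i)%MS.
    apply/row_subP => i; have [|x ->] := kerG (row i (kermx G)).
      by apply/sub_kermxP/row_sub.
    exact: scalemx_sub.
  move=> /mxrankS; rewrite mxrank_ker => le1.
  rewrite /row_full eqn_leq rank_leq_col /=.
  by have := leq_trans le1 (rank_leq_row _); rewrite leq_subLR addn1 ltnS.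
have [d dE] := gw _ hp.
have {dE} pE : p = \sum_j d j *: w j by apply/eqP; rewrite -subr_eq0; apply/eqP.
suff d0 : \col_j d j = 0.
  rewrite pE big1 // => j _; have /colP/(_ j) := d0.
  by rewrite !mxE => ->; rewrite scale0r.
rewrite -[\col_j d j]mul1mx -BG -mulmxA; suff -> : G *m \col_j d j = 0 by rewrite mulmx0.
apply/colP => i; rewrite !mxE; have : phi (u i * p) = 0.
  apply/phi0; first exact: hprod.
  by rewrite mulrC; apply: Op; move: (hu i); congr hdeg; lia.
rewrite pE mulr_sumr; under eq_bigr do rewrite -scalerAr.
rewrite scalar_sum // => {2}<-.
by apply: eq_bigr => j _; rewrite !mxE mulrC.
Qed.

(** A variable carries J_d into J_(d+1) injectively, so the vanishing propagates downwards from
    degree s - 1. *)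
Lemma orth_low d p : (d <= r)%N -> hdeg d p -> orth d p -> p = 0.
Proof.
move=> dr; move En: (r - d)%N => n; elim: n d En dr p => [|n IHn] d En dr p hp Op.
  have E : d = r by lia.
  by rewrite E in hp Op; apply: orth_mid.
apply: (@X_inj k o0); rewrite /= mulr0; apply: (IHn d.+1); [lia | lia | exact: hdegXM |].
by apply: orthXM Op; lia.
Qed.

(** * Vanishing of Tor_1 and Tor_2 in high degrees *)

(** Write p = div a. A test triple [b] for [curl_duality] has its curl in J in degree at most s - 1,
    so b = grad t and a . b = t div a is in I. Hence [a] is a curl plus a triple over J_d = I_d, and
    the curl does not contribute to [p]. *)
Lemma ideal_generation d p : (r.+1 < d)%N -> hdeg d.+1 p -> inI p ->
  exists2 u, all3 inI u & p = div u.
Proof.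
move=> rd /hdeg_div [a ha ->] Ip.
have [ed|de] := ltnP e d.
  by exists a => //; apply: all3_impl ha => q; apply: inI_above.
case: d rd de a ha Ip => // d rd de a ha Ip.
have [b hb Ob|c hc Oc] := curl_duality hI tau_notin tau_top (de : d < e)%N ha.
  have /curl_exact [t ->] : curl b = 0.
    case: Ob => O0 O1 O2; have hcb := hdeg3_curl hb.
    have E : (e - d.+1).+1 = (e - d)%N by lia.
    rewrite E in hcb; case: hcb => h0 h1 h2.
    by apply: triple_eq; apply: (@orth_low (e - d)) => //; lia.
  by rewrite dotC dot_grad; apply: inI_mul.
exists (a - curl c); last by rewrite divB div_curl subr0.
have hac : all3 (hdeg d.+1) (a - curl c).
  by apply: (subspaceB (subspace_all3 (subspace_hdeg _ _))) => //; apply: hdeg3_curl.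
by case: hac => ? ? ?; case: Oc => ? ? ?; split; apply: (@orth_high d.+1).
Qed.

(** The adjoint argument: u = curl b, and a test triple [a] has divergence zero, so a = curl t and a
    . b = - t . u is in I. Then [b] can be corrected by a gradient, which [curl] does not see. *)
Lemma syzygy_generation d u : (r.+1 < d)%N -> all3 (hdeg d.+1) u -> all3 inI u ->
  div u = 0 -> exists2 w, all3 inI w & u = curl w.
Proof.
move=> rd hu Iu /(div_exact_hdeg hu) [b hb uE].
have [ed|de] := ltnP e d.
  by exists b => //; apply: all3_impl hb => q; apply: inI_above.
case: d rd de b hb u hu Iu uE => // d rd de b hb u hu Iu uE.
have [a ha Oa|c hc Oc] := grad_duality hI tau_notin tau_top (de : d < e)%N hb.
  have /div_exact [t ->] : div a = 0.
    have hda := hdeg3_div ha.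
    have E : (e - d.+1).+1 = (e - d)%N by lia.
    by rewrite E in hda; apply: (@orth_low (e - d)) => //; lia.
  rewrite -[dot _ _]opprK -dot_curl -uE.
  by apply: (subspaceN (subspace_inI hI)); apply: inI_dot.
exists (b - grad c); last by rewrite curlB curl_grad subr0.
have hbc : all3 (hdeg d.+1) (b - grad c).
  by apply: (subspaceB (subspace_all3 (subspace_hdeg _ _))) => //; apply: hdeg3_grad.
by case: hbc => ? ? ?; case: Oc => ? ? ?; split; apply: (@orth_high d.+1).
Qed.

(** * Dimensions of the graded pieces of Tor_1 and Tor_2 *)

Local Notation div_ideal := (div_ideal I).
Local Notation curl_ideal := (curl_ideal I).

Definition syzdeg d u := all3 (idealdeg d) u /\ div u = 0.

Lemma subspace_syzdeg d : subspace (syzdeg d).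
Proof.
have sd := subspace_idealdeg3 hI d.
split=> [|c u v [Iu u0] [Iv v0]]; first by split; [apply: subspace0 | rewrite div0].
by split; [apply: sd.2 | rewrite divP u0 v0 scaler0 addr0].
Qed.

Lemma idealdeg3_low d u : (d <= r)%N -> all3 (idealdeg d) u -> u = 0.
Proof.
by move=> dr [[? ?] [? ?] [? ?]]; apply: triple_eq; apply: (@idealdeg_low d).
Qed.

Lemma div_idealdegP d p : hdeg d.+1 p ->
  div_ideal p <-> exists2 u, all3 (idealdeg d) u & p = div u.
Proof.
move=> hp; split=> [[u Iu pu]|[u /idealdeg3P[_ Iu] pu]]; last by exists u.
exists (hcomp3 d u); first exact: idealdeg3_hcomp.
by rewrite -hcomp_div -pu hcomp_id.
Qed.

Lemma curl_idealdegP d v : all3 (hdeg d.+1) v ->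
  curl_ideal v <-> exists2 w, all3 (idealdeg d) w & v = curl w.
Proof.
move=> hv; split=> [[u Iu vu]|[u /idealdeg3P[_ Iu] vu]]; last by exists u.
exists (hcomp3 d u); first exact: idealdeg3_hcomp.
by rewrite -hcomp_curl -vu hcomp3_id.
Qed.

Lemma dim_div_image d n : dim_mod (all3 (idealdeg d)) (syzdeg d) n ->
  dim_mod (fun p => exists2 u, all3 (idealdeg d) u & p = div u) (fun z => z = 0) n.
Proof.
apply: (dim_mod_push (f := @div k)).
- exact: divP.
- exact: subspace_idealdeg3.
- by move=> z; exists z.
- by move=> z cz; split=> [|[]].
- by move=> _ [u Iu ->]; exists u.
Qed.

Lemma dim_idealdeg3 d n : dim_mod (idealdeg d) (fun z => z = 0) n ->
  dim_mod (all3 (idealdeg d)) (fun z => z = 0) (3 * n).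
Proof. by apply: dim_all3; apply: subspace_idealdeg. Qed.

Lemma dim_syzdeg d n : dim_mod (idealdeg d) (fun z => z = 0) n ->
  exists x y, [/\ dim_mod (all3 (idealdeg d)) (syzdeg d) x,
    dim_mod (syzdeg d) (fun z => z = 0) y & (3 * n = x + y)%N].
Proof.
move=> /dim_idealdeg3; apply: dim_mod_split.
- exact: subspace_idealdeg3.
- exact: subspace_syzdeg.
- exact: subspace_eq0.
- by move=> z ->; apply: (subspace0 (subspace_syzdeg d)).
- by move=> z [].
Qed.

Lemma subspace_div_idealdeg d :
  subspace (fun p => exists2 u, all3 (idealdeg d) u & p = div u).
Proof.
have sd := subspace_idealdeg3 hI d.
split=> [|c _ _ [u Iu ->] [v Iv ->]]; first by exists 0; [apply: subspace0 | rewrite div0].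
by exists (c *: u + v); [apply: sd.2 | rewrite divP].
Qed.

Lemma subspace_curl_idealdeg d :
  subspace (fun v : R3 => exists2 u, all3 (idealdeg d) u & v = curl u).
Proof.
have sd := subspace_idealdeg3 hI d.
split=> [|c _ _ [u Iu ->] [v Iv ->]]; first by exists 0; [apply: subspace0 | rewrite curl0].
by exists (c *: u + v); [apply: sd.2 | rewrite curlP].
Qed.

(** [div] maps I_s^3, of dimension 3s, onto R_1 I_s with kernel of dimension t; in I_(s+1) this
    leaves 3s + 3 - (3s - t) = t + 3. *)
Lemma dim_linear_syzygies : exists t, dim_mod (syzdeg r.+1) (fun z => z = 0) t /\
  dim_mod (idealdeg r.+2) div_ideal (t + 3).
Proof.
have [x [t [dx dt xt]]] := dim_syzdeg dim_idealdeg_init; exists t; split=> //.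
have [n [m [dn dm nm]]] : exists n m, [/\
    dim_mod (idealdeg r.+2) (fun p => exists2 u, all3 (idealdeg r.+1) u & p = div u) n,
    dim_mod (fun p => exists2 u, all3 (idealdeg r.+1) u & p = div u) (fun z => z = 0) m &
    (3 * r.+1 + 3 = n + m)%N].
  apply: dim_mod_split dim_idealdeg_s1.
  - exact: subspace_idealdeg.
  - exact: subspace_div_idealdeg.
  - exact: subspace_eq0.
  - by move=> z ->; apply: (subspace0 (subspace_div_idealdeg _)).
  - move=> _ [u /idealdeg3P[hu Iu] ->]; split; first exact: hdeg3_div.
    exact: (inI_dot hI).
have xm := dim_mod_uniq (subspace_eq0 _) (dim_div_image dx) dm.
have -> : (t + 3)%N = n by lia.
move: dn; apply: dim_mod_id => // [|z [hz Iz]]; first exact: subspace_idealdeg.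
exact: div_idealdegP.
Qed.

(** A curl-free [u] is [grad c] with [c] a socle element of degree s - 1. There the socle is zero
    and so is I. *)
Lemma curl_idealdeg_inj u : all3 (idealdeg r.+1) u -> curl u = 0 -> u = 0.
Proof.
move=> /idealdeg3P[hu Iu] /(curl_exact_hdeg hu) [c hc uE].
suff c0 : c = 0 by rewrite uE c0 grad0.
apply: (@idealdeg_low r) => //; apply: (@socle_other r) => //; do ?[by apply/eqP; lia].
  move: Iu; rewrite uE => -[? ? ?] i; rewrite mulrC.
  by elim/ord3_ind: i.
Qed.

(** By [ideal_generation], [div] maps I_(s+1)^3 onto I_(s+2), so the kernel has dimension 3(3s + 3)
    - (5s + 5) = 4s + 4. The boundaries [curl] (I_s^3) take away 3s by [curl_idealdeg_inj]. *)
Lemma dim_quadratic_syzygies : dim_mod (syzdeg r.+2) curl_ideal (r.+1 + 4).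
Proof.
have [x [y [dx dy xy]]] := dim_syzdeg dim_idealdeg_s1.
have xE : x = (5 * r.+1 + 5)%N.
  apply: (dim_mod_uniq (subspace_eq0 _) (dim_div_image dx)).
  move: dim_idealdeg_s2; apply: dim_mod_ext => // z; split=> [[hz Iz]|].
    by apply/div_idealdegP => //; apply: (@ideal_generation r.+2).
  move=> [u /idealdeg3P[hu Iu] ->]; split; first exact: hdeg3_div.
  exact: (inI_dot hI).
have [n [m [dn dm nm]]] : exists n m, [/\
    dim_mod (syzdeg r.+2) (fun v => exists2 w, all3 (idealdeg r.+1) w & v = curl w) n,
    dim_mod (fun v => exists2 w, all3 (idealdeg r.+1) w & v = curl w) (fun z => z = 0) m &
    y = (n + m)%N].
  apply: dim_mod_split dy.
  - exact: subspace_syzdeg.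
  - exact: subspace_curl_idealdeg.
  - exact: subspace_eq0.
  - by move=> z ->; apply: (subspace0 (subspace_curl_idealdeg _)).
  - move=> _ [u /idealdeg3P[hu Iu] ->]; split; last exact: div_curl.
    by apply/idealdeg3P; split; [exact: hdeg3_curl | exact: (inI_cross hI)].
have mE : m = (3 * r.+1)%N.
  apply: (dim_mod_uniq (subspace_eq0 _) dm).
  move: (dim_idealdeg3 dim_idealdeg_init); apply: (dim_mod_push (f := @curl k)).
  - exact: curlP.
  - exact: subspace_idealdeg3.
  - by move=> u; exists u.
  - by move=> u Iu; split=> [/curl_idealdeg_inj->|->] //; apply: curl0.
  - by move=> _ [u Iu ->]; exists u.
have -> : (r.+1 + 4)%N = n by lia.
move: dn; apply: dim_mod_id => // [|z [/idealdeg3P[hz _] _]]; first exact: subspace_syzdeg.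
exact: curl_idealdegP.
Qed.

(** * Homogeneous bases of Tor_1 and Tor_2 *)

Lemma hcomp_linear d : linear_map (@hcomp k d).
Proof. by move=> c p q; apply: linearP. Qed.

Lemma div_ideal_hcomp d p : div_ideal p -> div_ideal (hcomp d p).
Proof.
move=> [u Iu ->]; case: d => [|d].
  by rewrite hcomp_div0; apply: (subspace0 (subspace_div_ideal hI)).
by rewrite hcomp_div; exists (hcomp3 d u) => //; apply: inI_hcomp3.
Qed.

Lemma curl_ideal_hcomp d u : curl_ideal u -> curl_ideal (hcomp3 d u).
Proof.
move=> [w Iw ->]; case: d => [|d].
  by rewrite hcomp_curl0; apply: (subspace0 (subspace_curl_ideal hI)).
by rewrite hcomp_curl; exists (hcomp3 d w) => //; apply: inI_hcomp3.
Qed.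

Lemma syzygy_hcomp d u : syzygy I u -> syzygy I (hcomp3 d u).
Proof.
move=> [Iu u0]; split; first exact: inI_hcomp3.
by rewrite -hcomp_div u0 linear0.
Qed.

(** In degree s nothing is divided out, because R_+ I starts in degree s + 1; above s + 1 everything
    is in R_+ I by [ideal_generation]. *)
Lemma basis_ideal n m (v : 'I_n -> R) (w : 'I_m -> R) :
  basis_mod (idealdeg r.+1) (fun z => z = 0) v ->
  basis_mod (idealdeg r.+2) div_ideal w ->
  basis_mod inI div_ideal (catf v w).
Proof.
have idealdegP d p : idealdeg d p <-> inI p /\ hcomp d p = p.
  split=> [[hp Ip]|[Ip <-]]; first by rewrite hcomp_id.
  by split; [exact: hdeg_hcomp | exact: inI_hcomp].
move=> bv bw; apply: (basis_mod_graded (pi := @hcomp k) (p := r.+1) (q := r.+2)).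
- exact: hcomp_linear.
- exact: subspace_inI.
- exact: subspace_div_ideal.
- by rewrite eqn_leq ltnn andbF.
- exact: hcompM.
- by move=> z; exists (mmeasure mdeg z); apply: hcomp_sum.
- by move=> d z; apply: inI_hcomp.
- exact: div_ideal_hcomp.
- move=> d z dp dq Iz; have Id := inI_hcomp hI d Iz; have hd := hdeg_hcomp d z.
  have [dr|rd] := leqP d r.
    by rewrite (idealdeg_low dr hd Id); apply: (subspace0 (subspace_div_ideal hI)).
  case: d dp dq rd Id hd => // d dp dq rd Id hd.
  by apply: (@ideal_generation d) => //; lia.
- move: bv; apply: basis_mod_id (subspace_idealdeg hI _) (idealdegP _) _.
  move=> z [hz Iz]; split=> [/(div_idealdegP hz) [u Iu ->]|->].
    by rewrite (idealdeg3_low (leqnn r) Iu) div0.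
  exact: (subspace0 (subspace_div_ideal hI)).
- by move: bw; apply: basis_mod_id (subspace_idealdeg hI _) (idealdegP _) _.
Qed.

Lemma basis_syzygy n m (v : 'I_n -> R3) (w : 'I_m -> R3) :
  basis_mod (syzdeg r.+2) curl_ideal v ->
  basis_mod (syzdeg r.+1) (fun z => z = 0) w ->
  basis_mod (syzygy I) curl_ideal (catf v w).
Proof.
have syzdegP d u : syzdeg d u <-> syzygy I u /\ hcomp3 d u = u.
  split=> [[/idealdeg3P[hu Iu] u0]|[[Iu u0] <-]]; first by rewrite hcomp3_id.
  split; first exact: idealdeg3_hcomp.
  by rewrite -hcomp_div u0 linear0.
move=> bv bw; apply: (basis_mod_graded (pi := @hcomp3 k) (p := r.+2) (q := r.+1)).
- exact: hcomp3_linear.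
- exact: subspace_syzygy.
- exact: subspace_curl_ideal.
- by rewrite eqn_leq ltnn.
- exact: hcomp3M.
- exact: hcomp3_sum.
- exact: syzygy_hcomp.
- exact: curl_ideal_hcomp.
- move=> d z dp dq Sz; have [Id Sd] := syzygy_hcomp d Sz; have hd := hdeg3_hcomp d z.
  have [dr|rd] := leqP d r.
    have -> : hcomp3 d z = 0 by apply: idealdeg3_low dr _; apply/idealdeg3P.
    exact: (subspace0 (subspace_curl_ideal hI)).
  case: d dp dq rd Id Sd hd => // d dp dq rd Id Sd hd.
  by apply: (@syzygy_generation d) => //; lia.
- by move: bv; apply: basis_mod_id (subspace_syzdeg _) (syzdegP _) _.
- move: bw; apply: basis_mod_id (subspace_syzdeg _) (syzdegP _) _.
  move=> z [/idealdeg3P[hz Iz] _]; split=> [/(curl_idealdegP hz) [u Iu ->]|->].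
    by rewrite (idealdeg3_low (leqnn r) Iu) curl0.
  exact: (subspace0 (subspace_curl_ideal hI)).
Qed.

(** The internal degree of a class exceeds the degree of its coefficients by 1 in Tor_1 and by 2 in
    Tor_2. The block [b1] of higher degree comes first, so that the blocks paired into degree e face
    each other. *)
Lemma tor_bases : exists t,
  exists a1 : 'I_r.+1 -> R3, exists a2 : 'I_(t + 3) -> R3,
  exists b1 : 'I_(r.+1 + 4) -> R3, exists b2 : 'I_t -> R3,
  [/\ (forall i, all3 (hdeg r) (a1 i)) /\ (forall i, all3 (hdeg r.+1) (a2 i)),
      (forall i, all3 (hdeg r.+1) (b1 i)) /\ (forall i, all3 (hdeg r) (b2 i)),
      basis_mod inI div_ideal (fun i => div (catf a1 a2 i)),
      basis_mod (syzygy I) curl_ideal (fun i => curl (catf b1 b2 i)) &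
      independent_mod (fun z => z = 0) (fun i => div (a1 i)) /\
      independent_mod (fun z => z = 0) (fun i => curl (b2 i))].
Proof.
have [v1 bv1] := dim_idealdeg_init; have [t [[w2 bw2] [v2 bv2]]] := dim_linear_syzygies.
have [w1 bw1] := dim_quadratic_syzygies.
have lift_div d (p : R) : idealdeg d.+1 p -> exists2 a, all3 (hdeg d) a & p = div a.
  by move=> [hp _]; apply: hdeg_div.
have lift_curl d (u : R3) : syzdeg d.+1 u -> exists2 b, all3 (hdeg d) b & u = curl b.
  by move=> [/idealdeg3P[hu _] u0]; apply: div_exact_hdeg.
have [a1 ha1 va1] : exists2 a1 : 'I_r.+1 -> R3,
    forall i, all3 (hdeg r) (a1 i) & forall i, v1 i = div (a1 i).
  have [Z1 _ _] := bv1; exact: fin_all_exists2 (fun i => lift_div r (v1 i) (Z1 i)).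
have [a2 ha2 va2] : exists2 a2 : 'I_(t + 3) -> R3,
    forall i, all3 (hdeg r.+1) (a2 i) & forall i, v2 i = div (a2 i).
  have [Z2 _ _] := bv2; exact: fin_all_exists2 (fun i => lift_div r.+1 (v2 i) (Z2 i)).
have [b1 hb1 wb1] : exists2 b1 : 'I_(r.+1 + 4) -> R3,
    forall i, all3 (hdeg r.+1) (b1 i) & forall i, w1 i = curl (b1 i).
  have [Z1 _ _] := bw1; exact: fin_all_exists2 (fun i => lift_curl r.+1 (w1 i) (Z1 i)).
have [b2 hb2 wb2] : exists2 b2 : 'I_t -> R3,
    forall i, all3 (hdeg r) (b2 i) & forall i, w2 i = curl (b2 i).
  have [Z2 _ _] := bw2; exact: fin_all_exists2 (fun i => lift_curl r (w2 i) (Z2 i)).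
have bv := basis_ideal bv1 bv2; have bw := basis_syzygy bw1 bw2.
exists t, a1, a2, b1, b2; split=> //.
- by move: bv; apply: eq_basis_mod => i; rewrite /catf; case: split.
- by move: bw; apply: eq_basis_mod => i; rewrite /catf; case: split.
- by split; [case: (eq_basis_mod va1 bv1) | case: (eq_basis_mod wb2 bw2)].
Qed.

(** * Products of Tor classes *)

(** The error term of [curl_duality] lies over J_(s-1) = 0, so [a] is exactly a curl. The test
    triples have their curls over J_(s+1) = I_(s+1), hence are cycles, and the assumption applies to
    them. *)
Lemma curl_pairing_nondegenerate a : all3 (hdeg r) a -> tor1_cycle I a ->
  (forall b, all3 (hdeg r.+1) b -> tor2_cycle I b -> inI (dot a b)) -> div a = 0.
Proof.
move=> ha Ia kill; have [r0 Er] : exists r0, r = r0.+1 by exists r.-1; lia.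
have [||b hb Ob|c hc Oc] := @curl_duality _ _ hI e _ tau_notin tau_top r0 a.
- by lia.
- by rewrite -Er.
- have hb' : all3 (hdeg r.+1) b by move: hb; congr (all3 (hdeg _)); lia.
  apply: kill => //; have hcb := hdeg3_curl hb'.
  have E : (e - r0 = r.+2)%N by lia.
  move: Ob; rewrite E => -[O0 O1 O2]; case: hcb => h0 h1 h2.
  by split; apply: (@orth_high r.+2) => //; lia.
have ac : a - curl c = 0.
  rewrite -Er in Oc; have hac : all3 (hdeg r) (a - curl c).
    apply: (subspaceB (subspace_all3 (subspace_hdeg _ _))) => //.
    by rewrite [in hdeg r]Er; apply: hdeg3_curl.
  by case: hac => ? ? ?; case: Oc => ? ? ?; apply: triple_eq; apply: orth_mid.
by rewrite -[a](subrK (curl c)) ac add0r div_curl.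
Qed.

Lemma grad_pairing_nondegenerate b : all3 (hdeg r) b -> tor2_cycle I b ->
  (forall a, all3 (hdeg r.+1) a -> tor1_cycle I a -> inI (dot a b)) -> curl b = 0.
Proof.
move=> hb Ib kill; have [r0 Er] : exists r0, r = r0.+1 by exists r.-1; lia.
have [||a ha Oa|c hc Oc] := @grad_duality _ _ hI e _ tau_notin tau_top r0 b.
- by lia.
- by rewrite -Er.
- have ha' : all3 (hdeg r.+1) a by move: ha; congr (all3 (hdeg _)); lia.
  apply: kill => //; have hda := hdeg3_div ha'.
  have E : (e - r0 = r.+2)%N by lia.
  by rewrite E in Oa; apply: (@orth_high r.+2) => //; lia.
have bc : b - grad c = 0.
  rewrite -Er in Oc; have hbc : all3 (hdeg r) (b - grad c).
    apply: (subspaceB (subspace_all3 (subspace_hdeg _ _))) => //.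
    by rewrite [in hdeg r]Er; apply: hdeg3_grad.
  by case: hbc => ? ? ?; case: Oc => ? ? ?; apply: triple_eq; apply: orth_mid.
by rewrite -[b](subrK (grad c)) bc add0r curl_grad.
Qed.

(** The product has internal degree d1 + d2 + 2 >= 2s, which exceeds s + 2 because s >= 3; Tor_2
    vanishes there by [syzygy_generation]. *)
Lemma cross_tor2_zero d1 d2 a b : (r <= d1)%N -> (r <= d2)%N ->
  all3 (hdeg d1) a -> all3 (hdeg d2) b ->
  tor1_cycle I a -> tor1_cycle I b -> tor2_zero I (cross a b).
Proof.
move=> rd1 rd2 ha hb Ia Ib; apply/(curl_idealP I).
apply: (@syzygy_generation (d1 + d2)); [by lia | | | exact: div_curl].
  exact/hdeg3_curl/hdeg_cross.
rewrite curl_cross; apply: (subspaceB (subspace_inI3 hI)); exact: (inI_smul hI).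
Qed.

Lemma sum_dot_tau n (c x : 'I_n -> k) (v : 'I_n -> R) :
  (forall i, inI (v i - x i *: tau)) -> \sum_i c i * x i = 0 ->
  inI (\sum_i c i *: v i).
Proof.
move=> Iv cx; have := subspace_lin (subspace_inI hI) c Iv.
under eq_bigr do rewrite scalerBr scalerA.
by rewrite sumrB -scaler_suml cx scale0r subr0.
Qed.

(** [M] is the matrix of products as multiples of [tau]; the bound on [m] yields the condition r >=
    2 in the definition of class G(r). *)
Lemma tor_pairing : exists2 m, (5 <= m)%N &
  exists A : 'I_m -> R3, exists B : 'I_(m + 1) -> R3, exists M : 'M[k]_(m, m + 1),
  [/\ basis_mod inI div_ideal (fun i => div (A i)) /\
        (forall i, exists d, hdeg d (div (A i))),
      basis_mod (tor1_cycle I) (tor1_zero I) A,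
      basis_mod (tor2_cycle I) (tor2_zero I) B,
      forall i j, tor2_zero I (cross (A i) (A j)) &
      (forall i j, inI (dot (A i) (B j) - M i j *: tau)) /\ \rank M = (m - 3)%N].
Proof.
have [t [a1 [a2 [b1 [b2 [[ha1 ha2] [hb1 hb2] bA bB [ia ib]]]]]]] := tor_bases.
have tA := basis_tor1 hI bA; have tB := basis_tor2 hI bB.
have [ZA _ _] := tA; have [ZB _ _] := tB.
have Za1 i : tor1_cycle I (a1 i) by have := ZA (lshift _ i); rewrite catf_l.
have Za2 i : tor1_cycle I (a2 i) by have := ZA (rshift _ i); rewrite catf_r.
have Zb1 i : tor2_cycle I (b1 i) by have := ZB (lshift _ i); rewrite catf_l.
have Zb2 i : tor2_cycle I (b2 i) by have := ZB (rshift _ i); rewrite catf_r.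
have p11 i j : exists x : k, inI (dot (a1 i) (b1 j) - x *: tau).
  by apply: tau_top; have := hdeg_dot (ha1 i) (hb1 j); congr hdeg; lia.
have p22 i j : exists x : k, inI (dot (a2 i) (b2 j) - x *: tau).
  by apply: tau_top; have := hdeg_dot (ha2 i) (hb2 j); congr hdeg; lia.
(* These products are socle elements of degree e - 1, where the socle is zero. *)
have p12 i j : inI (dot (a1 i) (b2 j)).
  apply: (@socle_other (r + r)); [by apply/eqP; lia | by apply/eqP; lia | |].
    exact: hdeg_dot.
  exact: socle_dot.
(* These products have degree e + 1, where R/I is zero. *)
have p21 i j : inI (dot (a2 i) (b1 j)).
  by apply: (@inI_above (r.+1 + r.+1)); [lia | exact: hdeg_dot].
have [P PE] := fin_all_exists (fun i => fin_all_exists (p11 i)).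
have [Q QE] := fin_all_exists (fun i => fin_all_exists (p22 i)).
pose MP := \matrix_(i, j) P i j; pose MQ := \matrix_(i, j) Q i j.
exists (r.+1 + (t + 3))%N; first by lia.
have -> : (r.+1 + (t + 3) + 1 = r.+1 + 4 + t)%N by lia.
exists (catf a1 a2), (catf b1 b2), (block_mx MP 0 0 MQ); split=> //.
- split=> //; apply: (catf_ind (Q := fun a => exists d, hdeg d (div a))) => i.
    by exists r.+1; apply: hdeg3_div.
  by exists r.+2; apply: hdeg3_div.
- have homA i : exists2 d, (r <= d)%N & all3 (hdeg d) (catf a1 a2 i).
    apply: (catf_ind (Q := fun a => exists2 d, (r <= d)%N & all3 (hdeg d) a)) i => i.
      by exists r.
    by exists r.+1.
  move=> i j; have [d1 rd1 h1] := homA i; have [d2 rd2 h2] := homA j.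
  exact: (cross_tor2_zero rd1 rd2 h1 h2).
split.
  apply: all_split => i; apply: all_split => j; rewrite ?catf_l ?catf_r.
  - by rewrite block_mxEul mxE.
  - by rewrite block_mxEur mxE scale0r subr0.
  - by rewrite block_mxEdl mxE scale0r subr0.
  - by rewrite block_mxEdr mxE.
(* [MP] has independent rows and [MQ] independent columns, so the ranks are s and t. *)
rewrite rank_diag_block_mx; have -> : (r.+1 + (t + 3) - 3 = r.+1 + t)%N by lia.
congr (_ + _)%N.
  apply/eqP; rewrite -/(row_free MP).
  apply: inj_row_free => c cP; apply/rowP => i; rewrite mxE; apply: (ia (c 0)).
  rewrite -(linear_map_lin (@divP k)).
  have Za : tor1_cycle I (\sum_i c 0 i *: a1 i).
    by apply: (subspace_lin (subspace_tor1_cycle hI)).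
  apply: curl_pairing_nondegenerate => // [|b hb Ib].
    by apply: (subspace_lin (subspace_all3 (subspace_hdeg k r))).
  apply: (inI_dot_basis_r hI tB) => //; apply: (catf_ind (Q := fun b => inI (dot _ b))) => j;
    rewrite (linear_map_lin (dot_linear_l _)).
    apply: (sum_dot_tau (x := fun i => P i j)) => //.
    by have /rowP/(_ j) := cP; rewrite !mxE => {2}<-; apply: eq_bigr => l _; rewrite mxE.
  exact: (subspace_lin (subspace_inI hI)).
rewrite -mxrank_tr; apply/eqP; rewrite -/(row_free MQ^T).
apply: inj_row_free => c cQ; apply/rowP => i; rewrite mxE.
apply: (ib (c 0)); rewrite -(linear_map_lin (@curlP k)).
have Zb : tor2_cycle I (\sum_i c 0 i *: b2 i).
  by apply: (subspace_lin (subspace_tor2_cycle hI)).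
apply: grad_pairing_nondegenerate => // [|a ha Ia].
  by apply: (subspace_lin (subspace_all3 (subspace_hdeg k r))).
set b := \sum_i _ in Zb *; suff Ab i' : inI (dot (catf a1 a2 i') b).
  exact: (inI_dot_basis_l hI tA Ab).
apply: (catf_ind (Q := fun a => inI (dot a b))) i' => j; rewrite (linear_map_lin (dotP _)).
  exact: (subspace_lin (subspace_inI hI)).
apply: (sum_dot_tau (x := Q j)) => //.
by have /rowP/(_ j) := cQ; rewrite !mxE => {2}<-; apply: eq_bigr => l _; rewrite !mxE.
Qed.

End Compressed.

(** * The Koszul algebra in coordinates *)

Section KoszulCoordinates.
Variable k : fieldType.
Local Notation R := {mpoly k[3]}.
Local Notation R3 := (R * R * R)%type.
Local Notation K := (koszul k 3).
Implicit Types (a u v : R3) (p q : R).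

(** A subset as its three membership bits, which reduces sums over subsets and their signs to finite
    case analysis. *)
Definition bits (b0 b1 b2 : bool) : {set 'I_3} :=
  [set i : 'I_3 | nth false [:: b0; b1; b2] i].

Lemma bitsE (U : {set 'I_3}) : U = bits (o0 \in U) (o1 \in U) (o2 \in U).
Proof. by apply/setP; elim/ord3_ind; rewrite inE. Qed.

Lemma in_bits b0 b1 b2 :
  ((o0 \in bits b0 b1 b2 = b0) * (o1 \in bits b0 b1 b2 = b1)
   * (o2 \in bits b0 b1 b2 = b2))%type.
Proof. by rewrite !inE. Qed.

Lemma bits_ind (Q : {set 'I_3} -> Prop) :
  (forall b0 b1 b2, Q (bits b0 b1 b2)) -> forall U, Q U.
Proof. by move=> Qb U; rewrite (bitsE U). Qed.

Lemma card_bits b0 b1 b2 : #|bits b0 b1 b2| = (b0 + (b1 + b2))%N.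
Proof. by rewrite -sum1_card big_mkcond big_ord3 /= !in_bits; case: b0 b1 b2 => [] [] []. Qed.

Lemma sum_bits (F : {set 'I_3} -> R) :
  \sum_U F U = \sum_(b0 : bool) \sum_(b1 : bool) \sum_(b2 : bool) F (bits b0 b1 b2).
Proof.
rewrite pair_bigA pair_bigA /=.
rewrite (reindex (fun t : bool * bool * bool => bits t.1.1 t.1.2 t.2)) //=.
exists (fun U : {set 'I_3} => (o0 \in U, o1 \in U, o2 \in U)) => [[[b0 b1] b2] _|U _] /=.
  by rewrite !in_bits.
by rewrite -bitsE.
Qed.

Lemma inv_count_bits b0 b1 b2 c0 c1 c2 :
  inv_count (bits b0 b1 b2) (bits c0 c1 c2) = (b1 * c0 + (b2 * c0 + b2 * c1))%N.
Proof.
transitivity (\sum_(i < 3) \sum_(j < 3)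
    [&& i \in bits b0 b1 b2, j \in bits c0 c1 c2 & (j < i)%N])%N.
  rewrite /inv_count -sum1_card big_mkcond pair_bigA /=.
  by apply: eq_bigr => -[i j] _; rewrite inE /=; case: ([&& _, _ & _]).
rewrite !big_ord3 !in_bits /=.
by case: b0 b1 b2 c0 c1 c2 => [] [] [] [] [] [].
Qed.

Lemma setU_bits b0 b1 b2 :
  ((o0 |: bits b0 b1 b2 = bits true b1 b2) * (o1 |: bits b0 b1 b2 = bits b0 true b2)
   * (o2 |: bits b0 b1 b2 = bits b0 b1 true))%type.
Proof. by do !split; apply/setP; elim/ord3_ind; rewrite !inE. Qed.

Lemma setD_bits b0 b1 b2 c0 c1 c2 :
  bits b0 b1 b2 :\: bits c0 c1 c2 = bits (b0 && ~~ c0) (b1 && ~~ c1) (b2 && ~~ c2).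
Proof. by apply/setP; elim/ord3_ind; rewrite !inE andbC. Qed.

Lemma subset_bits b0 b1 b2 c0 c1 c2 :
  (bits b0 b1 b2 \subset bits c0 c1 c2) = [&& b0 ==> c0, b1 ==> c1 & b2 ==> c2].
Proof.
apply/subsetP/and3P => [sub|[i0 i1 i2]].
  by split; apply/implyP; [have := sub o0 | have := sub o1 | have := sub o2]; rewrite !inE.
by elim/ord3_ind; rewrite !inE /=; apply/implyP.
Qed.

Lemma kmul_bits (x y : K) w0 w1 w2 : kmul x y (bits w0 w1 w2) =
  \sum_(b0 : bool) \sum_(b1 : bool) \sum_(b2 : bool)
    if [&& b0 ==> w0, b1 ==> w1 & b2 ==> w2] then
      let: (d0, d1, d2) := (w0 && ~~ b0, w1 && ~~ b1, w2 && ~~ b2) in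
      (-1) ^+ (b1 * d0 + (b2 * d0 + b2 * d1))
        * (x (bits b0 b1 b2) * y (bits d0 d1 d2))
    else 0.
Proof.
rewrite /kmul ffunE big_mkcond sum_bits /=.
do 3!(apply: eq_bigr => ? _); by rewrite subset_bits setD_bits inv_count_bits.
Qed.

Lemma kdiff_bits (x : K) w0 w1 w2 : kdiff x (bits w0 w1 w2) =
  (if w0 then 0 else 'X_o0 * x (bits true w1 w2)) +
  ((if w1 then 0 else (-1) ^+ w0 * ('X_o1 * x (bits w0 true w2))) +
   (if w2 then 0 else (-1) ^+ (w0 + w1) * ('X_o2 * x (bits w0 w1 true)))).
Proof.
have below i : #|[set j in bits w0 w1 w2 | (j < i)%N]| =
    ((w0 && (o0 < i)) + ((w1 && (o1 < i)) + (w2 && (o2 < i))))%N.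
  rewrite -sum1_card big_mkcond big_ord3 /= !inE /=.
  by do 3!case: (_ && _).
rewrite /kdiff ffunE big_mkcond big_ord3 /= !below !setU_bits !inE /=.
by case: w0 w1 w2 {below} => [] [] []; rewrite /= ?expr0 ?mul1r.
Qed.

Definition kof (f : bool -> bool -> bool -> R) : K :=
  [ffun U : {set 'I_3} => f (o0 \in U) (o1 \in U) (o2 \in U)].

Lemma kofE f b0 b1 b2 : kof f (bits b0 b1 b2) = f b0 b1 b2.
Proof. by rewrite ffunE !in_bits. Qed.

Definition k1 a : K := kof (fun b0 b1 b2 => match b0, b1, b2 with
  | true, false, false => a.1.1 | false, true, false => a.1.2
  | false, false, true => a.2 | _, _, _ => 0 end).

(* With these signs T_0 T_1 T_2 has coefficient [dot a b] in [k1 a * k2 b]. *)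
Definition k2 a : K := kof (fun b0 b1 b2 => match b0, b1, b2 with
  | false, true, true => a.1.1 | true, false, true => - a.1.2
  | true, true, false => a.2 | _, _, _ => 0 end).

Definition k3 (c : R) : K := kof (fun b0 b1 b2 => if [&& b0, b1 & b2] then c else 0).

Lemma koszul_eq (x y : K) :
  (forall b0 b1 b2, x (bits b0 b1 b2) = y (bits b0 b1 b2)) -> x = y.
Proof. by move=> xy; apply/ffunP; apply: bits_ind. Qed.

Lemma kdegP n (x : K) :
  kdeg n x <-> (forall b0 b1 b2 : bool, (b0 + (b1 + b2) != n)%N -> x (bits b0 b1 b2) = 0).
Proof.
split=> [xn b0 b1 b2|xn]; first by rewrite -card_bits; apply: xn.
by apply: bits_ind => b0 b1 b2; rewrite card_bits; apply: xn.
Qed.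

Lemma kdeg_k1 a : kdeg 1 (k1 a).
Proof. by apply/kdegP => -[] [] []; rewrite kofE. Qed.
Lemma kdeg_k2 a : kdeg 2 (k2 a).
Proof. by apply/kdegP => -[] [] []; rewrite kofE. Qed.
Lemma kdeg_k3 (c : R) : kdeg 3 (k3 c).
Proof. by apply/kdegP => -[] [] []; rewrite kofE. Qed.

Lemma kdeg1E (x : K) : kdeg 1 x -> exists a, x = k1 a.
Proof.
move=> /kdegP x1; exists (x (bits true false false), x (bits false true false),
  x (bits false false true)).
by apply: koszul_eq => -[] [] []; rewrite kofE //= x1.
Qed.

Lemma kdeg2E (x : K) : kdeg 2 x -> exists b, x = k2 b.
Proof.
move=> /kdegP x2; exists (x (bits false true true), - x (bits true false true),
  x (bits true true false)).
by apply: koszul_eq => -[] [] []; rewrite kofE /= ?opprK // x2.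
Qed.

Lemma kdeg3E (x : K) : kdeg 3 x -> exists c, x = k3 c.
Proof.
move=> /kdegP x3; exists (x (bits true true true)).
by apply: koszul_eq => -[] [] []; rewrite kofE //= x3.
Qed.

Lemma kdeg4E (x : K) : kdeg 4 x -> x = 0.
Proof. by move=> /kdegP x4; apply: koszul_eq => -[] [] []; rewrite x4 // ffunE. Qed.

Lemma k1_linear : linear_map k1.
Proof.
by move=> t u v; apply: koszul_eq => -[] [] []; rewrite !ffunE !in_bits //= scaler0 addr0.
Qed.

Lemma k2_linear : linear_map k2.
Proof.
move=> t u v; apply: koszul_eq => -[] [] []; rewrite !ffunE !in_bits //= ?scaler0 ?addr0 //.
by rewrite opprD scalerN.
Qed.

Lemma k3_linear : linear_map k3.
Proof.
by move=> t u v; apply: koszul_eq => -[] [] []; rewrite !ffunE !in_bits //= scaler0 addr0.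
Qed.

(** The sign is harmless: cycles and boundaries modulo I are closed under negation. *)
Lemma kdiff_k2 (b : R3) : kdiff (k2 b) = k1 (- curl b).
Proof.
apply: koszul_eq => b0 b1 b2; rewrite kdiff_bits !kofE.
by case: b0 b1 b2 => [] [] []; rewrite /= ?expr0 ?expr1 ?mulr0 ?addr0 //; ring.
Qed.

Lemma kdiff_k3 (c : R) : kdiff (k3 c) = k2 (grad c).
Proof.
apply: koszul_eq => b0 b1 b2; rewrite kdiff_bits !kofE.
by case: b0 b1 b2 => [] [] []; rewrite /= ?mulr0 ?addr0 //; ring.
Qed.

Lemma kdiff0 : kdiff (0 : K) = 0.
Proof.
apply: koszul_eq => b0 b1 b2; rewrite kdiff_bits !ffunE !mulr0.
by do 3!case: ifP => _; rewrite !addr0.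
Qed.

Lemma kmul_k1k1 (a b : R3) : kmul (k1 a) (k1 b) = k2 (cross a b).
Proof.
apply: koszul_eq => b0 b1 b2; rewrite kmul_bits !big_bool !kofE.
by case: b0 b1 b2 => [] [] []; rewrite /= ?mulr0 ?mul0r ?addr0 //; ring.
Qed.

Lemma kmul_k1k2 (a b : R3) : kmul (k1 a) (k2 b) = k3 (dot a b).
Proof.
apply: koszul_eq => b0 b1 b2; rewrite kmul_bits !big_bool !kofE.
by case: b0 b1 b2 => [] [] []; rewrite /= ?mulr0 ?mul0r ?addr0 // /dot; ring.
Qed.

Lemma kmul_k2k1 (a b : R3) : kmul (k2 b) (k1 a) = k3 (dot a b).
Proof.
apply: koszul_eq => b0 b1 b2; rewrite kmul_bits !big_bool !kofE.
by case: b0 b1 b2 => [] [] []; rewrite /= ?mulr0 ?mul0r ?addr0 // /dot; ring.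
Qed.

End KoszulCoordinates.

(** * Tor of the Koszul algebra and Tor in terms of triples *)

Section TorKoszul.
Variables (k : fieldType) (I : {pred {mpoly k[3]}}).
Hypothesis hI : homogeneous_ideal I.
Local Notation R := {mpoly k[3]}.
Local Notation R3 := (R * R * R)%type.
Local Notation inI := (inI I).
Local Notation K := (koszul k 3).

Let sI := subspace_inI hI.
Let sI3 := subspace_inI3 hI.
Let I0 : inI 0 := subspace0 sI.

Lemma in_IKP (x : K) : in_IK I x <-> (forall b0 b1 b2 : bool, inI (x (bits b0 b1 b2))).
Proof. by split=> [Ix b0 b1 b2|Ix]; [apply: Ix | apply: bits_ind]. Qed.

Lemma in_IK_k1 (a : R3) : in_IK I (k1 a) <-> all3 inI a.
Proof.
split=> [/in_IKP Ia|[? ? ?]]; last by apply/in_IKP => -[] [] []; rewrite kofE.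
by split; [have := Ia true false false | have := Ia false true false
  | have := Ia false false true]; rewrite kofE.
Qed.

Lemma in_IK_k2 (a : R3) : in_IK I (k2 a) <-> all3 inI a.
Proof.
split=> [/in_IKP Ia|[? ? ?]]; last first.
  by apply/in_IKP => -[] [] []; rewrite kofE //; apply: subspaceN.
split; [have := Ia false true true | have := Ia true false true
  | have := Ia true true false]; rewrite kofE //.
by move/(subspaceN sI); rewrite opprK.
Qed.

Lemma in_IK_k3 (c : R) : in_IK I (k3 c) <-> inI c.
Proof.
split=> [/in_IKP Ic|Ic]; last by apply/in_IKP => -[] [] []; rewrite kofE.
by have := Ic true true true; rewrite kofE.
Qed.

Lemma tor_cycle1P (a : R3) : tor_cycle I 1 (k1 a) <-> tor1_cycle I a.
Proof.
split=> [[_ /in_IKP/(_ false false false)]|Ia].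
  by rewrite kdiff_bits !kofE /= ?expr0 ?mul1r /tor1_cycle /div /dot addrA.
split; first exact: kdeg_k1.
apply/in_IKP => -[] [] []; rewrite kdiff_bits ?kofE /= ?mulr0 ?addr0 //.
by rewrite ?expr0 ?mul1r addrA.
Qed.

Lemma tor_cycle2P (b : R3) : tor_cycle I 2 (k2 b) <-> tor2_cycle I b.
Proof.
rewrite /tor_cycle kdiff_k2 in_IK_k1; split=> [[_ /(subspaceN sI3)]|Ib].
  by rewrite opprK.
by split; [exact: kdeg_k2 | exact: subspaceN].
Qed.

Lemma tor_cycle3P (c : R) : tor_cycle I 3 (k3 c) <-> socle I c.
Proof.
rewrite /tor_cycle kdiff_k3 in_IK_k2; split=> [[_ [h0 h1 h2]]|sc].
  by elim/ord3_ind; rewrite mulrC.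
by split; [exact: kdeg_k3 | split; rewrite /= mulrC; apply: sc].
Qed.

Lemma tor_zero1P (a : R3) : tor_zero I 1 (k1 a) <-> tor1_zero I a.
Proof.
split=> [[_ [_ /kdeg2E[b ->]]]|[b [u Iu ->]]].
  rewrite kdiff_k2 -(linear_mapB (@k1_linear k)) opprK => /in_IK_k1 Ia.
  by exists (- b), (a + curl b) => //; rewrite curlN addrCA addNr addr0.
split; first exact: kdeg_k1.
exists (k2 (- b)); first exact: kdeg_k2.
by rewrite kdiff_k2 curlN opprK -(linear_mapB (@k1_linear k)) addrC addKr; apply/in_IK_k1.
Qed.

Lemma tor_zero2P (b : R3) : tor_zero I 2 (k2 b) <-> tor2_zero I b.
Proof.
split=> [[_ [_ /kdeg3E[c ->]]]|[c [u Iu ->]]].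
  rewrite kdiff_k3 -(linear_mapB (@k2_linear k)) => /in_IK_k2 Ia.
  by exists c, (b - grad c) => //; rewrite addrC subrK.
split; first exact: kdeg_k2.
exists (k3 c); first exact: kdeg_k3.
by rewrite kdiff_k3 -(linear_mapB (@k2_linear k)) addrC addKr; apply/in_IK_k2.
Qed.

(** K_4 = 0, so no boundaries come in and a zero class has its coefficient in I. *)
Lemma tor_zero3P (c : R) : tor_zero I 3 (k3 c) <-> inI c.
Proof.
split=> [[_ [_ /kdeg4E->]]|Ic].
  by rewrite kdiff0 subr0 => /in_IK_k3.
split; first exact: kdeg_k3.
by exists 0; [move=> U _; rewrite ffunE | rewrite kdiff0 subr0; apply/in_IK_k3].
Qed.

Lemma tor_basis_k1 n (v : 'I_n -> R3) :
  basis_mod (tor1_cycle I) (tor1_zero I) v -> tor_basis I 1 (fun i => k1 (v i)).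
Proof.
apply: basis_mod_push.
- exact: k1_linear.
- exact: subspace_tor1_cycle.
- by move=> a; apply: (proj2 (tor_cycle1P a)).
- by move=> a _; apply: tor_zero1P.
- move=> x tx; have [a xa] := kdeg1E (proj1 tx).
  by exists a => //; apply/tor_cycle1P; rewrite -xa.
Qed.

Lemma tor_basis_k2 n (v : 'I_n -> R3) :
  basis_mod (tor2_cycle I) (tor2_zero I) v -> tor_basis I 2 (fun i => k2 (v i)).
Proof.
apply: basis_mod_push.
- exact: k2_linear.
- exact: subspace_tor2_cycle.
- by move=> a; apply: (proj2 (tor_cycle2P a)).
- by move=> a _; apply: tor_zero2P.
- move=> x tx; have [a xa] := kdeg2E (proj1 tx).
  by exists a => //; apply/tor_cycle2P; rewrite -xa.
Qed.

Lemma subspace_socle : subspace (socle I).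
Proof.
split=> [i|c u v su sv i]; first by rewrite mulr0.
by rewrite mulrDr -scalerAr; apply: sI.2; [apply: su | apply: sv].
Qed.

Lemma tor_basis_k3 n (v : 'I_n -> R) :
  basis_mod (socle I) inI v -> tor_basis I 3 (fun i => k3 (v i)).
Proof.
apply: basis_mod_push.
- exact: k3_linear.
- exact: subspace_socle.
- by move=> a; apply: (proj2 (tor_cycle3P a)).
- by move=> a _; apply: tor_zero3P.
- move=> x tx; have [a xa] := kdeg3E (proj1 tx).
  by exists a => //; apply/tor_cycle3P; rewrite -xa.
Qed.

End TorKoszul.

(** * Minimal generators *)

Section IdealGen.
Variable R : comNzRingType.
Implicit Types (fs : seq R) (p q : R).

Lemma ideal_gen0 fs : ideal_gen fs 0.
Proof. by exists (fun _ => 0); rewrite big1 // => i _; rewrite mul0r. Qed.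

Lemma ideal_genD fs p q : ideal_gen fs p -> ideal_gen fs q -> ideal_gen fs (p + q).
Proof.
move=> [a ->] [b ->]; exists (fun i => a i + b i); rewrite -big_split /=.
by apply: eq_bigr => i _; rewrite mulrDl.
Qed.

Lemma ideal_genM fs p q : ideal_gen fs q -> ideal_gen fs (p * q).
Proof.
move=> [a ->]; exists (fun i => p * a i); rewrite mulr_sumr.
by apply: eq_bigr => i _; rewrite mulrA.
Qed.

Lemma ideal_gen_sum fs n (F : 'I_n -> R) :
  (forall i, ideal_gen fs (F i)) -> ideal_gen fs (\sum_i F i).
Proof. by move=> gF; elim/big_ind: _ => //; [apply: ideal_gen0 | apply: ideal_genD]. Qed.

Lemma ideal_gen_mem fs p : p \in fs -> ideal_gen fs p.
Proof.
move=> fp; have ip : (index p fs < size fs)%N by rewrite index_mem.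
exists (fun i => (i == Ordinal ip)%:R); rewrite (bigD1 (Ordinal ip)) //= eqxx mul1r.
rewrite nth_index // big1 ?addr0 // => i /negbTE ->; exact: mul0r.
Qed.

End IdealGen.

Section MinimalGenerators.
Variables (k : fieldType) (I : {pred {mpoly k[3]}}).
Hypothesis hI : homogeneous_ideal I.
Local Notation R := {mpoly k[3]}.
Local Notation inI := (inI I).

Let sI := subspace_inI hI.

Lemma ideal_gen_sub fs p : (forall q, q \in fs -> inI q) -> ideal_gen fs p -> inI p.
Proof.
move=> Ifs [a ->]; apply: (subspace_sum sI) => i.
by apply: (inI_mul hI); apply/Ifs/mem_nth.
Qed.

(* Graded Nakayama. *)
Lemma generates_basis m (w : 'I_m -> R) :
  basis_mod inI (div_ideal I) w -> (forall i, exists d, hdeg d (w i)) ->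
  generates I [seq w i | i <- enum 'I_m].
Proof.
move=> [Iw _ gw] hw p; set fs := [seq _ | _ <- _]; split; last first.
  by apply: ideal_gen_sub => _ /mapP [i _ ->].
have gw' i : ideal_gen fs (w i).
  by apply: ideal_gen_mem; apply: map_f; rewrite mem_enum.
have gC (c : k) q : ideal_gen fs q -> ideal_gen fs (c *: q).
  by move=> gq; rewrite -mul_mpolyC; apply: ideal_genM.
suff gen d q : hdeg d q -> inI q -> ideal_gen fs q.
  move=> Ip; rewrite (hcomp_sum (leqnn _) (p := p)); apply: ideal_gen_sum => d.
  by apply: gen (hdeg_hcomp d p) _; apply: inI_hcomp.
elim: d q => [|d IHd] q hq /gw [c [u Iu quE]].
all: have qE : q = \sum_i c i *: w i + div u by rewrite -quE addrC subrK.
all: rewrite -(hcomp_id hq) qE (linear_mapD (@hcomp_linear k _)).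
all: rewrite (linear_map_lin (@hcomp_linear k _)).
all: apply: ideal_genD; first apply: ideal_gen_sum => i; first apply: gC.
1, 3: have [d' hd'] := hw i.
1: have [e|ne] := eqVneq d' 0%N; first by rewrite hcomp_id // -e.
1: by rewrite (hcomp_ne hd' ne); apply: ideal_gen0.
1: have [e|ne] := eqVneq d' d.+1; first by rewrite hcomp_id // -e.
1: by rewrite (hcomp_ne hd' ne); apply: ideal_gen0.
- by rewrite hcomp_div0; apply: ideal_gen0.
- rewrite hcomp_div; have [h0 h1 h2] := inI_hcomp3 hI d Iu.
  have [k0 k1 k2] := hdeg3_hcomp d u.
  by do 2?apply: ideal_genD; apply/ideal_genM/IHd.
Qed.

(** Modulo R_+ I only the constant terms of coefficients survive, so every generating family spans I
    / R_+ I over k and has at least [m] members. *)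
Lemma min_num_gens_basis m (w : 'I_m -> R) :
  basis_mod inI (div_ideal I) w -> (forall i, exists d, hdeg d (w i)) ->
  min_num_gens I m.
Proof.
move=> bw hw; split.
  by exists [seq w i | i <- enum 'I_m]; [rewrite size_map size_enum_ord | exact: generates_basis].
move=> fs gfs; have [Iw iw _] := bw.
apply: (independent_mod_le (subspace_div_ideal hI) iw (w := fun i => fs`_i)) => i.
have /gfs [a wE] := Iw i.
have [c cE] := fin_all_exists (fun j => constant_or_div (a j)).
have [b bE] := fin_all_exists cE; exists c; rewrite wE -sumrB.
apply: (subspace_sum (subspace_div_ideal hI)) => j; rewrite bE mulrDl mul_mpolyC.
rewrite addrC addKr; exists (smul fs`_j (b j)); last by rewrite div_smul mulrC.
apply: (inI_smul hI); apply/gfs/ideal_gen_mem/mem_nth/ltn_ord.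
Qed.

End MinimalGenerators.

Lemma ideal_gen_squares (k : fieldType) d (p : {mpoly k[3]}) : hdeg d.+2 p ->
  ideal_gen [seq 'X_i * 'X_j | i <- enum 'I_3, j <- enum 'I_3] p.
Proof.
set fs := [seq _ | _ <- _, _ <- _].
have gX i j : ideal_gen fs ('X_i * 'X_j : {mpoly k[3]}).
  by apply/ideal_gen_mem/allpairs_f; rewrite mem_enum.
have gX1 i q : hdeg d.+1 q -> ideal_gen fs ('X_i * q).
  move=> /hdeg_div [a _ ->]; rewrite /div /dot /= !mulrDr !mulrA.
  by do 2?apply: ideal_genD; rewrite mulrC; apply: ideal_genM.
by move=> /hdeg_div [a [? ? ?] ->]; do 2?apply: ideal_genD; apply: gX1.
Qed.

(** * Normal form of the multiplication *)

Section NormalForm.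
Variables (k : fieldType) (I : {pred {mpoly k[3]}}).
Hypothesis hI : homogeneous_ideal I.
Local Notation R := {mpoly k[3]}.
Local Notation R3 := (R * R * R)%type.
Local Notation inI := (inI I).

Lemma dot_change (tau : R) m n (A : 'I_m -> R3) (B : 'I_n -> R3)
    (M : 'M[k]_(m, n)) (L : 'M_m) (U : 'M_n) :
  (forall i j, inI (dot (A i) (B j) - M i j *: tau)) ->
  forall i j, inI (dot (\sum_a L i a *: A a) (\sum_b U j b *: B b)
                   - (L *m M *m U^T) i j *: tau).
Proof.
move=> ABM i j; have sI := subspace_inI hI.
rewrite (linear_map_lin (dot_linear_l _)) -mulmxA mxE scaler_suml -sumrB.
apply: (subspace_sum sI) => a.
rewrite -scalerA -scalerBr; apply: (subspaceZ sI).
rewrite (linear_map_lin (dotP _)) mxE scaler_suml -sumrB.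
apply: (subspace_sum sI) => b.
by rewrite mxE mulrC -scalerA -scalerBr; apply: (subspaceZ sI).
Qed.

Lemma cross_change m (A : 'I_m -> R3) (L : 'M[k]_m) :
  (forall i j, tor2_zero I (cross (A i) (A j))) ->
  forall i j, tor2_zero I (cross (\sum_a L i a *: A a) (\sum_b L j b *: A b)).
Proof.
move=> A0 i j; have s0 := subspace_tor2_zero hI.
rewrite (linear_map_lin (@cross_linear k _)).
apply: (subspace_lin s0) => b; rewrite crossC; apply: (subspaceN s0).
by rewrite (linear_map_lin (@cross_linear k _)); apply: (subspace_lin s0).
Qed.

(** Row and column operations bring [M] to the partial identity of its rank; the products within
    Tor_1 remain zero by bilinearity. *)
Lemma tor_normal_form (tau : R) m n (A : 'I_m -> R3) (B : 'I_n -> R3) (M : 'M[k]_(m, n)) :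
  basis_mod (tor1_cycle I) (tor1_zero I) A ->
  basis_mod (tor2_cycle I) (tor2_zero I) B ->
  (forall i j, tor2_zero I (cross (A i) (A j))) ->
  (forall i j, inI (dot (A i) (B j) - M i j *: tau)) ->
  exists A' : 'I_m -> R3, exists B' : 'I_n -> R3,
  [/\ basis_mod (tor1_cycle I) (tor1_zero I) A',
      basis_mod (tor2_cycle I) (tor2_zero I) B',
      forall i j, tor2_zero I (cross (A' i) (A' j)) &
      forall (i : 'I_m) (j : 'I_n), inI (dot (A' i) (B' j)
        - (((i : nat) == j) && (i < \rank M)%N)%:R *: tau)].
Proof.
move=> bA bB cA ABM.
(* By [dot_change] the new matrix is L M U^T, so the column factor enters transposed. *)
pose L := invmx (col_ebase M); pose U := (invmx (row_ebase M))^T.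
exists (fun i => \sum_a L i a *: A a), (fun j => \sum_b U j b *: B b); split.
- apply: basis_mod_change bA; first exact: subspace_tor1_cycle.
  by rewrite unitmx_inv col_ebase_unit.
- apply: basis_mod_change bB; first exact: subspace_tor2_cycle.
  by rewrite unitmx_tr unitmx_inv row_ebase_unit.
- exact: cross_change.
move=> i j; have := dot_change L U ABM i j; congr (inI (_ - _ *: _)).
suff -> : L *m M *m U^T = pid_mx (\rank M) by rewrite mxE.
rewrite /L /U trmxK -{2}(mulmx_ebase M) -!mulmxA mulKmx ?col_ebase_unit //.
by rewrite mulmxV ?row_ebase_unit // mulmx1.
Qed.

End NormalForm.

Theorem lemma8p6 (k : fieldType) (s : nat) (hs : (3 <= s)%N)
    (I : {pred {mpoly k[3]}})
    (hI : homogeneous_ideal I)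
    (hgrade : has_grade I 3)
    (hsoc : socle_iso I [:: s; (2 * s - 1)%N])
    (hcompr : compressed I (2 * s - 1)) :
  exists2 mu : nat, min_num_gens I mu & tor_class_G I (mu - 3).
Proof.
case: s hs hsoc hcompr => // r r_ge2.
have -> : (2 * r.+1 - 1 = 2 * r + 1)%N by lia.
move=> [v hv [sv iv gv]] hcompr.
pose i0 : 'I_2 := ord0; pose i1 : 'I_2 := lift ord0 ord0.
have [sigma sigmaE] : exists sigma, sigma = v i0 by exists (v i0).
have [tau tauE] : exists tau, tau = v i1 by exists (v i1).
have sum2 (c : 'I_2 -> k) : \sum_i c i *: v i = c i0 *: sigma + c i1 *: tau.
  by rewrite !big_ord_recl big_ord0 addr0 -sigmaE -tauE.
have sigma_deg : hdeg r.+1 sigma by rewrite sigmaE; apply: (hv i0).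
have tau_deg : hdeg (2 * r + 1) tau by rewrite tauE; apply: (hv i1).
have sigma_socle : socle I sigma by rewrite sigmaE.
have tau_socle : socle I tau by rewrite tauE.
have socle_free (x y : k) : inI I (x *: sigma + y *: tau) -> x = 0 /\ y = 0.
  pose c (i : 'I_2) := if i == i0 then x else y.
  have := iv c; rewrite sum2 => Ic /Ic c0.
  by have := c0 i0; have := c0 i1.
have socle_span p : socle I p -> exists x y : k, inI I (p - (x *: sigma + y *: tau)).
  by move=> /gv [c]; rewrite sum2; exists (c i0), (c i1).
have [m m5 [A [B [M [[bw hw] bA bB cA [ABM rM]]]]]] := tor_pairing hI r_ge2
  sigma_deg tau_deg sigma_socle tau_socle socle_free socle_span hcompr.
have gens := min_num_gens_basis hI bw hw.
have [A' [B' [bA' bB' cA' ABM']]] := tor_normal_form hI bA bB cA ABM.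
exists m => //; split; first by lia.
  move=> p Ip; rewrite (hcomp_sum (leqnn _) (p := p)); apply: ideal_gen_sum => d.
  have Id := inI_hcomp hI d Ip; have hd := hdeg_hcomp d p.
  have [dr|rd] := leqP d r.
    rewrite (idealdeg_low hI r_ge2 sigma_deg tau_deg sigma_socle tau_socle socle_free
      socle_span hcompr dr hd Id).
    exact: ideal_gen0.
  case: (nat_of_ord d) hd rd {Id} => [|[|d']] hd rd; [lia | lia |].
  exact (ideal_gen_squares hd).
(* The type is 2 = 1.+1, so Tor_2 has dimension m + 1. *)
exists m, 1%N; split=> //; [by exists v | by lia |].
(* All nonzero products lie in degree e, so [tau] has to come first, opposite to the order of the
   given socle basis. *)
pose g (i : 'I_2) := if i == i0 then tau else sigma.
have bg : basis_mod (socle I) (inI I) g.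
  split=> [i|c|p /socle_span [x [y Ixy]]]; first by rewrite /g; case: ifP.
    rewrite !big_ord_recl big_ord0 addr0 /g /= addrC => /socle_free [c1 c0].
    by move=> i; case: (unliftP ord0 i) => [j|] ->; rewrite ?(ord1 j).
  exists (fun i => if i == i0 then y else x).
  by rewrite !big_ord_recl big_ord0 addr0 /g /= [_ *: tau + _]addrC.
exists (fun i => k1 (A' i)), (fun j => k2 (B' j)), (fun i => k3 (g i)); split.
- exact: tor_basis_k1.
- exact: tor_basis_k2.
- exact: tor_basis_k3.
- by move=> i j; rewrite kmul_k1k1; apply/tor_zero2P.
- move=> i j; have := ABM' i j; rewrite rM kmul_k1k2 kmul_k2k1 /tor_eq.
  case: ifP => _; rewrite ?scale1r ?scale0r ?subr0 => Iij.
    by rewrite -(linear_mapB (@k3_linear k)); split; apply/(tor_zero3P hI).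
  by split; apply/(tor_zero3P hI).
Qed.
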